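(* Let $(\bar x,\bar\lambda)=(\bar x^1,\dots,\bar x^N,\bar\lambda^1,\dots,\bar\lambda^N)\in S_{\rm KKT}(\bar p)$. The following are equivalent: (i) $S_{\rm KKT}$ has a continuously differentiable single-valued localization around $\bar p$ for $(\bar x,\bar\lambda)$; (ii) the SCSC and the LICQ hold for each player $k$ at $(\bar p^k,\bar x^k,\bar\lambda^k)$, $k=1,\dots,N$, and moreover, for any $y=(y^1,\dots,y^N)\in M$, $$\begin{pmatrix}\nabla^2_{x^1x^1}L^1&\cdots&\nabla^2_{x^1x^N}L^1\\ \vdots&&\vdots\\ \nabla^2_{x^Nx^1}L^N&\cdots&\nabla^2_{x^Nx^N}L^N\end{pmatrix}\begin{pmatrix}y^1\\ \vdots\\ y^N\end{pmatrix}\in M^\perp\ \Longrightarrow\ y=0 .$$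
   Context: Nash equilibrium problem (NEP) with canonical perturbations. There are $N$ players; player $k$ has strategy $x^k\in\mathbb R^{n_k}$; $x=(x^1,\dots,x^N)\in\mathbb R^n$, $n=n_1+\cdots+n_N$; $x^{-k}$ denotes the other players' strategies. Parameters: $p^k=(u^k,v^k,w^k)\in\mathbb R^{m_k}\times\mathbb R^{n_k}\times\mathbb R^{d_k}$, $p=(p^1,\dots,p^N)$, identified with $(u,v,w)\in\mathbb R^{m}\times\mathbb R^n\times\mathbb R^d$, $m=\sum m_k$, $d=\sum d_k$. Given $x^{-k},p^k$, player $k$ solves $$\min_{x^k}\ f^k(x^k,x^{-k};w^k)-\langle v^k,x^k\rangle\ \text{ s.t. } g^k_i(x^k;w^k)=u^k_i\ (i=1,\dots,s_k),\ \ g^k_j(x^k;w^k)\le u^k_j\ (j=s_k+1,\dots,m_k),$$ with $f^k\in C^2(\mathbb R^n\times\mathbb R^{d_k})$, $g^k_i\in C^2(\mathbb R^{n_k}\times\mathbb R^{d_k})$. Lagrangian: $L^k(x^k,x^{-k},\lambda^k;w^k)=f^k(x^k,x^{-k};w^k)+\sum_{i=1}^{m_k}\lambda^k_ig^k_i(x^k;w^k)$. KKT mapping: $S_{\rm KKT}(p)$ is the set of $(x,\lambda)\in\mathbb R^n\times\mathbb R^m$ such that for each $k$: $v^k=\nabla_{x^k}L^k(x^k,x^{-k},\lambda^k;w^k)$; $g^k_i(x^k;w^k)=u^k_i$ for $i\le s_k$; and $\lambda^k_j\ge0$, $g^k_j(x^k;w^k)\le u^k_j$, $\lambda^k_j(g^k_j(x^k;w^k)-u^k_j)=0$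 for $j>s_k$. Notation at $(\bar p,\bar x,\bar\lambda)\in{\rm gph}\,S_{\rm KKT}$: $\nabla^2_{x^kx^i}L^k\in\mathbb R^{n_k\times n_i}$ is the matrix of second partials $\partial^2L^k/\partial x^k_a\partial x^i_b$ evaluated at $(\bar x^k,\bar x^{-k},\bar\lambda^k;\bar w^k)$. Index sets: $I^k_1=\{1,\dots,s_k\}\cup\{i\in[s_k+1,m_k]:\bar\lambda^k_i>0=g^k_i(\bar x^k;\bar w^k)-\bar u^k_i\}$, $I^k_2=\{i\in[s_k+1,m_k]:\bar\lambda^k_i=0=g^k_i(\bar x^k;\bar w^k)-\bar u^k_i\}$. $M^k=\{y^k\in\mathbb R^{n_k}:\nabla_{x^k}g^k_i(\bar x^k;\bar w^k)^{\mathrm T}y^k=0\ \forall i\in I^k_1\}$ and $M=M^1\times\cdots\times M^N$; $M^\perp$ is its orthogonal complement in $\mathbb R^n$. LICQ for player $k$: the vectors $\nabla_{x^k}g^k_i(\bar x^k;\bar w^k)$, $i\in I^k_1\cup I^k_2$, are linearly independent. SCSC (strict complementary slackness condition) for player $k$ at $(\bar p^k,\bar x^k,\bar\lambda^k)$: $I^k_2=\emptyset$. A set-valued mapping $\Phi$ has a continuously differentiable single-valued localization around $\bar a$ for $\bar b$ if $\bar b\in\Phi(\bar a)$ and there are neighborhoods $U$ of $\bar a$, $V$ of $\bar b$ such that ${\rm gph}\,\Phi\cap(U\times V)$ is the graph of a continuously differentiable single-valued mapping $U\to V$. *)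

(* Defs.v *)
From HB Require Import structures.
From mathcomp Require Import all_boot all_order all_algebra.
From mathcomp Require Import all_classical all_reals all_analysis.
Set Implicit Arguments.
Unset Strict Implicit.
Unset Printing Implicit Defensive.
Import Order.TTheory GRing.Theory Num.Theory.
Import numFieldNormedType.Exports.

Local Open Scope classical_set_scope.
Local Open Scope ring_scope.

(* [C1_on] is meant for open [A].  The spaces used below are finite-dimensional,
   so continuity of every directional derivative amounts to continuity of the
   Frechet derivative in operator norm. *)
Definition C1_on (R : realType) (V W : normedModType R) (A : set V)
    (F : V -> W) : Prop :=
  forall x, A x ->
    differentiable F x /\ forall v : V, {for x, continuous (fun z => 'D_v F z)}.

Definition C2 (R : realType) (V W : normedModType R) (F : V -> W) : Prop :=
  C1_on setT F /\ forall v : V, C1_on setT (fun z => 'D_v F z).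

(* The neighbourhoods [U] and [V] are open, so that continuous differentiability
   on [U] makes sense; only the values of [sigma] on [U] matter. *)
Definition has_C1_localization (R : realType) (A B : normedModType R)
    (Phi : A -> set B) (a : A) (b : B) : Prop :=
  Phi a b /\
  exists (U : set A) (V : set B) (sigma : A -> B),
    [/\ open_nbhs a U, open_nbhs b V, C1_on U sigma &
        [set z | Phi z.1 z.2] `&` (U `*` V)
          = [set z | U z.1 /\ z.2 = sigma z.1]].

Definition dotr (R : realType) (q : nat) (a b : 'rV[R]_q) : R :=
  \sum_(j < q) a 0 j * b 0 j.

Definition orthogonal_compl (R : realType) (q : nat) (A : set 'rV[R]_q) :
    set 'rV[R]_q :=
  [set z | forall y, A y -> dotr z y = 0].

Definition partial (R : realType) (q : nat) (F : 'rV[R]_q -> R) (j : 'I_q)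
    (x : 'rV[R]_q) : R :=
  'D_(delta_mx 0 j) F x.

(* Joint vectors are row vectors of length [\sum_k dim k]: the block of player
   [k] in [x] is [submxrow x k], and its coordinate [a] is the coordinate
   [tagnat.Rank k a] of [x].  The first [neqcon k] constraints of player [k] are
   equalities, the other ones are inequalities. *)
Record nep (R : realType) (N : nat) := Nep {
  nvar : 'I_N -> nat;
  ncon : 'I_N -> nat;
  npar : 'I_N -> nat;
  neqcon : 'I_N -> nat;
  neqcon_le_ncon : forall k, (neqcon k <= ncon k)%N;
  cost : forall k, 'rV[R]_(\sum_i nvar i) * 'rV[R]_(npar k) -> R;
  constr : forall k, 'I_(ncon k) -> 'rV[R]_(nvar k) * 'rV[R]_(npar k) -> R;
  cost_C2 : forall k, C2 (@cost k);
  constr_C2 : forall k (i : 'I_(ncon k)), C2 (constr i)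
}.

Arguments cost {R N} n k _.
Arguments constr {R N} n k _ _.

Section KKT.
Context {R : realType} {N : nat} (P : nep R N).

Local Notation strategies := 'rV[R]_(\sum_i nvar P i).
Local Notation multipliers := 'rV[R]_(\sum_i ncon P i).
(* parameters (u, v, w) *)
Local Notation parameters :=
  ('rV[R]_(\sum_i ncon P i) * 'rV[R]_(\sum_i nvar P i)
   * 'rV[R]_(\sum_i npar P i))%type.

Definition par_u (p : parameters) k : 'rV[R]_(ncon P k) := submxrow p.1.1 k.
Definition par_v (p : parameters) k : 'rV[R]_(nvar P k) := submxrow p.1.2 k.
Definition par_w (p : parameters) k : 'rV[R]_(npar P k) := submxrow p.2 k.

Definition lagrangian k (x : strategies) (lam : 'rV[R]_(ncon P k))
    (w : 'rV[R]_(npar P k)) : R :=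
  cost P k (x, w) + \sum_(i < ncon P k) lam 0 i * constr P k i (submxrow x k, w).

Definition grad_lagrangian k (x : strategies) (lam : 'rV[R]_(ncon P k))
    (w : 'rV[R]_(npar P k)) : 'rV[R]_(nvar P k) :=
  \row_(a < nvar P k)
    partial (fun z => lagrangian z lam w) (tagnat.Rank k a) x.

(* entry (a, b) differentiates the a-th component of the gradient of L^k in
   x^k with respect to x^i_b *)
Definition hess_lagrangian k i (x : strategies) (lam : 'rV[R]_(ncon P k))
    (w : 'rV[R]_(npar P k)) : 'M[R]_(nvar P k, nvar P i) :=
  \matrix_(a < nvar P k, b < nvar P i)
    partial (fun z => partial (fun z' => lagrangian z' lam w)
                              (tagnat.Rank k a) z)
            (tagnat.Rank i b) x.

Definition grad_constr k (i : 'I_(ncon P k)) (xk : 'rV[R]_(nvar P k))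
    (w : 'rV[R]_(npar P k)) : 'rV[R]_(nvar P k) :=
  \row_(a < nvar P k) partial (fun z => constr P k i (z, w)) a xk.

Definition S_KKT (p : parameters) : set (strategies * multipliers) :=
  [set xl | forall k,
    let xk := submxrow xl.1 k in
    let lam := submxrow xl.2 k in
    [/\ par_v p k = grad_lagrangian xl.1 lam (par_w p k),
        forall i : 'I_(ncon P k), (i < neqcon P k)%N ->
          constr P k i (xk, par_w p k) = par_u p k 0 i
      & forall j : 'I_(ncon P k), (neqcon P k <= j)%N ->
          [/\ 0 <= lam 0 j, constr P k j (xk, par_w p k) <= par_u p k 0 j
            & lam 0 j * (constr P k j (xk, par_w p k) - par_u p k 0 j) = 0]]].

Section AtPoint.
Variables (p : parameters) (x : strategies) (lam : multipliers).

Definition slack k (i : 'I_(ncon P k)) : R :=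
  constr P k i (submxrow x k, par_w p k) - par_u p k 0 i.

Definition I1 k : {set 'I_(ncon P k)} :=
  finset (fun i : 'I_(ncon P k) => (i < neqcon P k)%N ||
    [&& (neqcon P k <= i)%N, 0 < submxrow lam k 0 i & slack i == 0]).

Definition I2 k : {set 'I_(ncon P k)} :=
  finset (fun i : 'I_(ncon P k) =>
    [&& (neqcon P k <= i)%N, submxrow lam k 0 i == 0 & slack i == 0]).

Definition LICQ k : Prop :=
  free [seq grad_constr i (submxrow x k) (par_w p k)
       | i <- enum (I1 k :|: I2 k)%SET].

Definition SCSC k : Prop := I2 k = finset.set0.

Definition Mk k : set 'rV[R]_(nvar P k) :=
  [set y | forall i, i \in I1 k ->
     dotr (grad_constr i (submxrow x k) (par_w p k)) y = 0].

Definition Mprod : set (strategies) := [set y | forall k, Mk (submxrow y k)].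

Definition hess_block : 'M[R]_(\sum_i nvar P i, \sum_i nvar P i) :=
  \mxblock_(k < N, i < N)
    hess_lagrangian (k := k) i x (submxrow lam k) (par_w p k).

End AtPoint.
End KKT.

(* Main.v *)
(** Under strict complementarity the KKT conditions are equivalent, near the
    reference point, to a square system [kkt_map J z = param_map J p] in
    z = (x, lambda, w), where J is the set of active constraints: inactive
    multipliers vanish and active constraints hold with equality.  By the
    inverse function theorem this system has a C^1 localization as soon as its
    derivative is injective.  Conversely, if the derivative kills h, then p can
    be moved, with zero velocity, so that the line through the reference point
    in direction h consists of KKT points; the chain rule applied to the
    localization then forces h = 0.  Injectivity of the derivative is, by
    linear algebra, LICQ together with the second-order condition.  Strict
    complementarity itself follows from the existence of a C^1 localization:
    relaxing a degenerate constraint leaves the solution unchanged, so the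
    corresponding directional derivative of the localization is 0, whereas
    tightening it must move the constraint value at unit speed. *)

From HB Require Import structures.
Require Import Defs.
From mathcomp Require Import all_boot all_order all_algebra.
From mathcomp Require Import all_classical all_reals all_analysis.
From mathcomp Require Import lra ring.
Import Order.TTheory GRing.Theory Num.Theory.
Import numFieldNormedType.Exports.
Set Implicit Arguments.
Unset Strict Implicit.
Unset Printing Implicit Defensive.
Local Open Scope classical_set_scope.
Local Open Scope ring_scope.

(** * Sup norm and linear maps on row vectors, differentiability in epsilon form *)

Section RowVectors.
Context {R : realType}.

Lemma coord_le_norm q (x : 'rV[R]_q) j : `|x 0 j| <= `|x|.
Proof.
rewrite [leRHS]/Num.Def.normr/= mx_normrE.
exact: (le_bigmax _ _ (0, j)).
Qed.

Lemma norm_rV_le q (x : 'rV[R]_q) (e : R) :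
  0 <= e -> (forall j, `|x 0 j| <= e) -> `|x| <= e.
Proof.
move=> e0 xe; rewrite [leLHS]/Num.Def.normr/= mx_normrE.
by apply: bigmax_le => // -[i j] _; rewrite (ord1 i).
Qed.

(** Expanding in the canonical basis turns [f] into a finite sum of coordinate functions times fixed
    vectors. *)
Lemma linear_rV_continuous q (W : normedModType R)
  (f : {linear 'rV[R]_q -> W}) : continuous f.
Proof.
have -> : f = (fun z => \sum_j (z 0 j : R) *: f (delta_mx 0 j)) :> (_ -> _).
  apply/funext => z; rewrite {1}(row_sum_delta z) linear_sum.
  by apply: eq_bigr => j _; rewrite linearZ.
have cf j : continuous (fun z : 'rV[R]_q => (z 0 j : R) *: f (delta_mx 0 j)).
  by move=> z; apply: continuousZr_tmp; exact: coord_continuous.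
by apply: continuous_big => [|j _]; [exact: add_continuous|exact: cf].
Qed.

Lemma differentiable_eps (V W : normedModType R) (f : V -> W) x
    (L : {linear V -> W}) : continuous L ->
  (forall e, 0 < e -> \forall h \near (0 : V),
     `|f (h + x) - f x - L h| <= e * `|h|) ->
  differentiable f x /\ 'd f x = L :> (V -> W).
Proof.
move=> cL fL.
have E : f \o shift x = cst (f x) + L +o_ 0 id.
  apply/eqaddoP => e e0; have := fL _ e0; apply: filterS => h /=.
  by rewrite !fctE /= opprD addrA.
have dE := diff_unique cL E; split => //.
by apply/diff_locallyP; rewrite dE.
Qed.

End RowVectors.

(** * A mean value inequality on balls *)

Section MeanValue.
Context {R : realType}.

Lemma is_derive_line (V : normedModType R) (f : V -> R) z h t :
  differentiable f (z + t *: h) ->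
  is_derive t 1 (fun s : R => f (z + s *: h)) ('D_h f (z + t *: h)).
Proof.
move=> df; have dd := diff_derivable (v := h) df.
have E : (fun s : R => s^-1 *:
      (((fun s : R => f (z + s *: h)) \o shift t) (s *: 1)
       - f (z + t *: h))) =
         (fun s : R => s^-1 *: ((f \o shift (z + t *: h)) (s *: h)
            - f (z + t *: h))).
  apply/funext => s /=; congr (_ *: (f _ - _)).
  by rewrite scalerDl addrCA [s%:A]mulr1.
by split; [rewrite /derivable E; exact: dd|rewrite /derive E].
Qed.

(** The scalar mean value theorem is applied to each coordinate along the segment from [z2] to [z1].
    The intermediate point depends on the coordinate, which is harmless because the norm of a row
    vector is the maximum over its coordinates. *)
Lemma mean_value_ball (V : normedModType R) r (F : V -> 'rV[R]_r) a rho
    (T : V -> 'rV[R]_r) (e : R) : 0 <= e ->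
  (forall z, differentiable F z) ->
  (forall z, ball a rho z -> forall h, `|'D_h F z - T h| <= e * `|h|) ->
  forall z1 z2, ball a rho z1 -> ball a rho z2 ->
    `|F z1 - F z2 - T (z1 - z2)| <= e * `|z1 - z2|.
Proof.
move=> e0 dF FT z1 z2 z1B z2B; set h := z1 - z2.
apply: norm_rV_le => [|j]; first by rewrite mulr_ge0.
have dFj z : differentiable (fun z => F z 0 j) z.
  by apply: (@differentiable_comp _ _ _ _ F
       (fun M : 'rV[R]_r => M 0 j) z (dF z));
     exact: differentiable_coord.
have DFj z : 'D_h (fun z => F z 0 j) z = ('D_h F z) 0 j.
  by rewrite derive_mx ?mxE //; exact: diff_derivable.
pose phi (s : R) : R := F (z2 + s *: h) 0 j.
have dphi (s : R) : is_derive s 1 phi (('D_h F (z2 + s *: h)) 0 j).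
  by rewrite -DFj; apply: (is_derive_line (f := fun z => F z 0 j)).
have [|c cI] := @MVT R phi (fun s => ('D_h F (z2 + s *: h)) 0 j) 0 1 ltr01.
  apply: derivable_within_continuous => x _.
  exact: (@ex_derive _ _ _ _ _ _ _ (dphi x)).
rewrite subr0 mulr1 /phi scale1r scale0r addr0 {1}/h subrKC => E.
(* Balls are convex: the intermediate point is a convex combination of [z1] and [z2]. *)
have Bc : ball a rho (z2 + c *: h).
  move: z1B z2B; rewrite -!ball_normE /ball_/= => z1B z2B.
  have -> : a - (z2 + c *: h) = (1 - c) *: (a - z2) + c *: (a - z1).
    have -> : c *: (a - z1) = c *: (a - z2) - c *: h.
      by rewrite -scalerBr /h opprB addrA subrK.
    by rewrite scalerBl scale1r addrA subrK opprD addrA.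
  move: cI; rewrite in_itv/= => /andP[c0 c1].
  apply: (le_lt_trans (ler_normD _ _)); rewrite !normrZ.
  rewrite (gtr0_norm c0) gtr0_norm ?subr_gt0//.
  have c1' : 0 < 1 - c by rewrite subr_gt0.
  nra.
have := FT _ Bc h; apply: le_trans; apply: le_trans (coord_le_norm _ j).
by rewrite !mxE E.
Qed.

End MeanValue.

(** * The inverse function theorem for row vectors *)

Section InverseFunction.
Context {R : realType}.

(** Continuity of the finitely many partial derivatives yields continuity of the derivative in
    operator norm, since ['D_h F] is the combination of the partials with the coordinates of [h]. *)
Lemma C1_derive_near q (W : normedModType R) (F : 'rV[R]_q -> W)
    (a : 'rV[R]_q) :
  C1_on setT F -> forall e : R, 0 < e ->
  \forall z \near a, forall h, `|'D_h F z - 'D_h F a| <= e * `|h|.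
Proof.
move=> F1 e e0; have dF z : differentiable F z by have [] := F1 z I.
(* The [q] partials contribute at most [q * d <= e]; dividing by [q.+1] keeps [d] meaningful when
   [q = 0]. *)
pose d : R := e / q.+1%:R.
have d0 : 0 < d by rewrite divr_gt0// ltr0n.
have near_coord (j : 'I_q) : \forall z \near a,
    `|'D_(delta_mx 0 j) F z - 'D_(delta_mx 0 j) F a| <= d.
  have [_ /(_ (delta_mx 0 j))] := F1 a I.
  move=> /cvgrPdist_le /(_ _ d0); apply: filterS => z.
  by rewrite distrC.
have near_coords : \forall z \near a, forall j : 'I_q,
    `|'D_(delta_mx 0 j) F z - 'D_(delta_mx 0 j) F a| <= d.
  exact: (@filter_forall _ _ (fun (j : 'I_q) z =>
    `|'D_(delta_mx 0 j) F z - 'D_(delta_mx 0 j) F a| <= d) _ (nbhs_filter a)).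
apply: filterS near_coords => z Hz h.
have E z' : 'D_h F z' = \sum_j (h 0 j : R) *: 'D_(delta_mx 0 j) F z'.
  rewrite deriveE// {1}(row_sum_delta h) linear_sum.
  by apply: eq_bigr => j _; rewrite linearZ deriveE.
rewrite !E -sumrB (le_trans (ler_norm_sum _ _ _))//.
apply: (@le_trans _ _ (\sum_(j < q) `|h| * d)).
  apply: ler_sum => j _; rewrite -scalerBr normrZ.
  by apply: ler_pM => //; exact: coord_le_norm.
rewrite sumr_const card_ord -mulr_natr -mulrA mulrC ler_wpM2r//.
rewrite /d mulrAC ler_pdivrMr ?ltr0n// ler_wpM2l ?ler_nat//.
exact: ltW.
Qed.

Lemma derive_inj_jacobian_unit q (F : 'rV[R]_q -> 'rV[R]_q) (a : 'rV[R]_q) :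
  differentiable F a -> (forall h, 'D_h F a = 0 -> h = 0) ->
  jacobian F a \in unitmx.
Proof.
move=> dF inj; rewrite -row_free_unit; apply/inj_row_free => v.
by rewrite -deriveEjacobian//; exact: inj.
Qed.

Lemma mulmxr_bound q r (B : 'M[R]_(q, r)) :
  exists2 K : R, 0 < K & forall h : 'rV[R]_q, `|h *m B| <= K * `|h|.
Proof.
have [K K0 H] := linear_lipschitz
  (@linear_rV_continuous R q 'rV[R]_r (mulmxr B)).
by exists K.
Qed.

(* [B] is the inverse of the Jacobian matrix of [F] at [a]. *)
Lemma local_inverse_estimates q (F : 'rV[R]_q -> 'rV[R]_q) (a : 'rV[R]_q) :
  C1_on setT F -> (forall h, 'D_h F a = 0 -> h = 0) ->
  exists r K : R, exists B : 'M[R]_q, [/\ 0 < r, 0 < K, B \in unitmx,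
    forall h : 'rV_q, `|h *m B| <= K * `|h| &
    (forall z1 z2, ball a r z1 -> ball a r z2 ->
      `|z1 - z2 - (F z1 - F z2) *m B| <= 2^-1 * `|z1 - z2|) /\
    (forall z h, ball a r z -> `|h| <= 2 * K * `|'D_h F z|)].
Proof.
move=> F1 inj; have dF z : differentiable F z by have [] := F1 z I.
have Ju := derive_inj_jacobian_unit (dF a) inj.
set J := jacobian F a in Ju; pose B := invmx J.
have [K K0 BK] := mulmxr_bound B.
(* With this tolerance on the variation of the derivative, multiplication by [B], which costs a
   factor [K], leaves the contraction constant [1/2]. *)
have e0 : 0 < (2 * K)^-1 by rewrite invr_gt0 mulr_gt0.
have /nbhs_ballP[r /= r0 near_a] := C1_derive_near a F1 e0.
have DFa h : 'D_h F a *m B = h.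
  by rewrite deriveEjacobian// /B mulmxK.
have half x : K * ((2 * K)^-1 * x) = 2^-1 * x.
  by rewrite invfM mulrA mulrCA divff ?gt_eqF// mulr1.
exists r, K, B; split => //; first by rewrite unitmx_inv.
split=> [z1 z2 z1B z2B|z h zB].
  have /(_ _ _ z1B z2B) := mean_value_ball (ltW e0) dF near_a.
  move=> /(ler_wpM2l (ltW K0)); rewrite half; apply: le_trans.
  apply: le_trans (BK _).
  by rewrite -normrN opprB [in leRHS]mulmxBl DFa.
have := near_a _ zB h => /(ler_wpM2l (ltW K0)); rewrite half => H.
have : `|h| <= K * `|'D_h F z| + 2^-1 * `|h|.
  rewrite -{1}(DFa h) -[X in X *m B](subrK ('D_h F z)) mulmxDl addrC.
  apply: le_trans (ler_normD _ _) _; apply: lerD => //.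
  by apply: le_trans H; rewrite distrC; exact: BK.
lra.
Qed.

(** Solving [F z = y] amounts to finding a fixed point of the Newton step with frozen matrix [B];
    the estimate on [F] makes this step contract with constant [1/2]. *)
Lemma local_surjection q (F : 'rV[R]_q -> 'rV[R]_q) (a : 'rV[R]_q) (r K : R)
    (B : 'M[R]_q) : 0 < r -> 0 < K -> B \in unitmx -> continuous F ->
  (forall h : 'rV_q, `|h *m B| <= K * `|h|) ->
  (forall z1 z2, ball a r z1 -> ball a r z2 ->
      `|z1 - z2 - (F z1 - F z2) *m B| <= 2^-1 * `|z1 - z2|) ->
  forall y : 'rV[R]_q, `|F a - y| < r / (4 * K) ->
    exists2 z, ball a r z & F z = y.
Proof.
move=> r0 K0 Bu cF BK FB y ya.
(* [T] is a contraction of a closed ball; minimizing [`|z - T z|] over this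
   compact ball yields a fixed point. *)
pose T (z : 'rV[R]_q) : 'rV[R]_q := z - (F z - y) *m B.
pose U := closed_ball a (r / 2).
have r20 : 0 < r / 2 by rewrite divr_gt0.
have UE z : U z <-> `|a - z| <= r / 2 by rewrite /U closed_ballE.
have Ur z : U z -> ball a r z.
  rewrite UE -ball_normE /ball_/= => /le_lt_trans; apply.
  by rewrite ltr_pdivrMr// ltr_pMr// ltr1n.
have Ua : U a by apply/UE; rewrite subrr normr0 ltW.
have Tctr z1 z2 : U z1 -> U z2 -> `|T z1 - T z2| <= 2^-1 * `|z1 - z2|.
  move=> /Ur z1B /Ur z2B; apply: le_trans (FB _ _ z1B z2B).
  have -> : F z1 - F z2 = F z1 - y - (F z2 - y) by rewrite opprB addrA subrK.
  by rewrite /T [in leRHS]mulmxBl !opprB [_ *m B - z2]addrC addrACA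
    [X in `|_ + X| <= _]addrC.
(* The bound [r / (4 * K)] on [F a - y] makes [T] move the centre by at most [r / 4], and
   contraction of a ball of radius [r / 2] adds another [r / 4]. *)
have TU z : U z -> U (T z).
  move=> zU; apply/UE.
  have H1 := Tctr _ _ Ua zU; move: (zU) => /UE H2.
  have H3 : `|a - T a| <= r / 4.
    rewrite /T opprB addrC subrK; apply: le_trans (BK _) _.
    by rewrite mulrC -ler_pdivlMr// -mulrA -invfM ltW.
  rewrite -(subrKA (T a)); apply: le_trans (ler_normD _ _) _.
  lra.
have cT : continuous (fun z : 'rV[R]_q => `|z - T z|).
  have -> : (fun z : 'rV[R]_q => `|z - T z|) =
      (fun z : 'rV[R]_q => `|(F z - y) *m B|).
    by apply/funext => z; rewrite /T opprB addrC subrK.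
  have cB := @linear_rV_continuous R q 'rV[R]_q (mulmxr B).
  have cFy : continuous (fun z : 'rV[R]_q => F z - y).
    by move=> z; apply: (continuousB (cF z)); exact: cst_continuous.
  have cFB : continuous (mulmxr B \o (fun z : 'rV[R]_q => F z - y)).
    by move=> z; apply: continuous_comp; [exact: cFy|exact: cB].
  move=> z; apply: (continuous_comp (cFB z)); exact: norm_continuous.
have cU : compact U.
  apply: bounded_closed_compact; last exact: closed_ball_closed.
  exists (`|a| + r / 2); split => [|M aM z /UE zr]; first exact: num_real.
  rewrite -(subKr a z); apply: le_trans (ler_normB _ _) _.
  by apply: le_trans (ltW aM); rewrite lerD2l.
have [||z] := @EVT_min_rV R q (fun z : 'rV[R]_q => `|z - T z|) U _ cU.
- by exists a.
- exact: continuous_subspaceT.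
rewrite inE => zU zmin; exists z; first exact: Ur.
(* Minimality bounds [z - T z] by [T z - T (T z)], which contraction bounds by half of [z - T z];
   hence both vanish. *)
have := zmin (T z); rewrite inE => /(_ (TU _ zU)) H1.
have H2 := Tctr _ _ zU (TU _ zU).
have : `|z - T z| <= 0 by lra.
rewrite normr_le0 /T opprB addrC subrK => /eqP FB0.
apply/eqP; rewrite -subr_eq0; apply/eqP.
by rewrite -(mulmxK Bu (F z - y)) FB0 mul0mx.
Qed.

Lemma differentiable_near (V W : normedModType R) (f : V -> W) x :
  differentiable f x -> forall e : R, 0 < e ->
  \forall h \near (0 : V), `|f (h + x) - f x - 'd f x h| <= e * `|h|.
Proof.
move=> /diff_locally df e e0.
have /eqaddoP/(_ _ e0) := df; apply: filterS => h.
by rewrite !fctE /= opprD addrA.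
Qed.

Lemma continuous_atP (V W : normedModType R) (f : V -> W) x :
  {for x, continuous f} <->
  forall e : R, 0 < e -> \forall y \near x, `|f x - f y| <= e.
Proof. by split => [/cvgrPdist_le|fx]; [exact|apply/cvgrPdist_le]. Qed.

(** Local surjectivity provides a preimage near [a], and the contraction estimate makes it unique
    and Lipschitz in the value. Differentiability of [G] comes from inverting the first-order
    expansion of [F]. *)
Lemma inverse_function_theorem q (F : 'rV[R]_q -> 'rV[R]_q) (a : 'rV[R]_q) :
  C1_on setT F -> (forall h, 'D_h F a = 0 -> h = 0) ->
  exists (A W : set 'rV[R]_q) (G : 'rV[R]_q -> 'rV[R]_q),
    [/\ open_nbhs a A, open_nbhs (F a) W, C1_on W G,
        forall y, W y -> A (G y) /\ F (G y) = y &
        forall z, A z -> W (F z) -> G (F z) = z].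
Proof.
move=> F1 inj; have dF z : differentiable F z by have [] := F1 z I.
have cF : continuous F by move=> z; exact: differentiable_continuous.
have [r [K [B [r0 K0 Bu BK [FB DF]]]]] := local_inverse_estimates F1 inj.
have surj := local_surjection r0 K0 Bu cF BK FB.
have lip z1 z2 : ball a r z1 -> ball a r z2 ->
    `|z1 - z2| <= 2 * K * `|F z1 - F z2|.
  move=> z1B z2B; have H1 := FB _ _ z1B z2B; have H2 := BK (F z1 - F z2).
  have : `|z1 - z2| <= `|z1 - z2 - (F z1 - F z2) *m B| + `|(F z1 - F z2) *m B|.
    by rewrite -{1}(subrK ((F z1 - F z2) *m B) (z1 - z2)) ler_normD.
  lra.
have injF z1 z2 : ball a r z1 -> ball a r z2 -> F z1 = F z2 -> z1 = z2.
  move=> z1B z2B E; have := lip _ _ z1B z2B.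
  by rewrite E subrr normr0 mulr0 normr_le0 subr_eq0 => /eqP.
pose W : set 'rV[R]_q := ball (F a) (r / (4 * K)).
have rho0 : 0 < r / (4 * K) by rewrite divr_gt0// mulr_gt0.
(* Stated for every [y] so that choice yields a total function; outside [W] its value is
   arbitrary. *)
have exG y : exists z, W y -> ball a r z /\ F z = y.
  have [Wy|nWy] := pselect (W y); last by exists 0.
  have [|z zB Fz] := surj y; first by move: Wy; rewrite /W -ball_normE.
  by exists z.
have [G GP] := choice exG.
have oW : open W by exact: ball_open.
have GB y : W y -> ball a r (G y) by move=> /GP[].
have FG y : W y -> F (G y) = y by move=> /GP[].
have Glip y1 y2 : W y1 -> W y2 -> `|G y1 - G y2| <= 2 * K * `|y1 - y2|.
  move=> W1 W2; have := lip _ _ (GB _ W1) (GB _ W2).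
  by rewrite !FG.
have Ju y : W y -> jacobian F (G y) \in unitmx.
  move=> Wy; apply: derive_inj_jacobian_unit (dF _) _ => h Dh0.
  have := DF _ h (GB _ Wy).
  by rewrite Dh0 normr0 mulr0 normr_le0 => /eqP.
have dG y0 : W y0 -> differentiable G y0 /\
    'd G y0 = mulmxr (invmx (jacobian F (G y0))) :> ('rV_q -> 'rV_q).
  move=> Wy0; set J := jacobian F (G y0).
  apply: differentiable_eps => [|e e0]; first exact: linear_rV_continuous.
  have [K1 K10 JK1] := mulmxr_bound (invmx J).
  (* The tolerance anticipates two losses: [K1] from the inverse Jacobian and the Lipschitz constant
     [2 * K] of [G]. *)
  have d0 : 0 < e / (K1 * (2 * K)) by rewrite divr_gt0// !mulr_gt0.
  have /nbhs_norm0P[s /= s0 Fs] := differentiable_near (dF (G y0)) d0.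
  have Wnear : \forall h \near (0 : 'rV[R]_q), W (h + y0).
    have /nbhs_ballP[d /= d1 yW] : nbhs y0 W by exact: open_nbhs_nbhs.
    apply/nbhs_norm0P; exists d => //= h hd; apply: yW.
    by rewrite -ball_normE /ball_/= opprD addrCA subrr addr0 normrN.
  have snear : \forall h \near (0 : 'rV[R]_q), `|h| < s / (2 * K).
    by apply/nbhs_norm0P; exists (s / (2 * K)) => //=;
      rewrite divr_gt0// mulr_gt0.
  near=> h.
  have Wh : W (h + y0) by near: h.
  have hs : `|h| < s / (2 * K) by near: h.
  set k := G (h + y0) - G y0.
  have kh : `|k| <= 2 * K * `|h|.
    by apply: le_trans (Glip _ _ Wh Wy0) _; rewrite addrK.
  have ks : `|k| < s.
    by apply: le_lt_trans kh _; rewrite mulrC -ltr_pdivlMr// mulr_gt0.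
  have := Fs _ ks; rewrite /k subrK !FG// addrK -deriveE// deriveEjacobian//.
  rewrite -/k -/J => H.
  (* Since [h] is the increment of [F] for the displacement [k], the remainder of [G] is that of [F]
     carried through the inverse Jacobian. *)
  have E : k - h *m invmx J = - ((h - k *m J) *m invmx J).
    by rewrite mulmxBl mulmxK ?Ju// opprB.
  rewrite /= E normrN; apply: le_trans (JK1 _) _.
  move: H => /(ler_wpM2l (ltW K10)) /le_trans; apply.
  have : K1 * (e / (K1 * (2 * K)) * `|k|) <=
      K1 * (e / (K1 * (2 * K)) * (2 * K * `|h|)).
    by rewrite !ler_pM2l.
  move/le_trans; apply.
  rewrite le_eqVlt; apply/orP; left; apply/eqP; field.
  by rewrite !gt_eqF.
have DG y v : W y -> 'D_v G y = v *m invmx (jacobian F (G y)).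
  by move=> Wy; have [dGy dE] := dG _ Wy; rewrite deriveE// dE.
exists (ball a r), W, G; split.
- by split; [exact: ball_open|exact: ballxx].
- by split => //; exact: ballxx.
- move=> y0 Wy0; have [dG0 _] := dG _ Wy0; split => // v.
  have cG : {for y0, continuous G} by exact: differentiable_continuous.
  (* Continuity of matrix inversion is bypassed: the derivative of [F] at [G y] sends ['D_v G y] to
     [v], so [DF] bounds [h0 - 'D_v G y] by ['D_h0 F (G y) - v], which tends to 0. *)
  set h0 := 'D_v G y0.
  have cD : {for y0, continuous (fun y => 'D_h0 F (G y))}.
    have [_ /(_ h0) cDF] := F1 (G y0) I.
    exact: (@continuous_comp _ _ _ G (fun z => 'D_h0 F z) y0 cG cDF).
  have D0 : 'D_h0 F (G y0) = v.
    by rewrite deriveEjacobian// /h0 DG// mulmxKV// Ju.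
  apply/continuous_atP => e e0; rewrite -/h0.
  have d0 : 0 < e / (2 * K) by rewrite divr_gt0// mulr_gt0.
  have nW : \forall y \near y0, W y by exact: open_nbhs_nbhs.
  move/continuous_atP : cD => /(_ _ d0); rewrite D0 => nD.
  near=> y.
  have Wy : W y by near: y.
  have Hy : `|v - 'D_h0 F (G y)| <= e / (2 * K) by near: y.
  rewrite distrC; apply: le_trans (DF (G y) _ (GB _ Wy)) _.
  rewrite mulrC -ler_pdivlMr ?mulr_gt0//; apply: le_trans Hy.
  rewrite le_eqVlt; apply/orP; left; apply/eqP; congr (`|_|).
  by rewrite DG// !deriveEjacobian// mulmxBl mulmxKV// Ju.
- by move=> y Wy; split; [exact: GB|exact: FG].
- by move=> z zA WFz; apply: injF => //; [exact: GB|exact: FG].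
Unshelve. all: by end_near. Qed.

End InverseFunction.

(** * Linear maps given by the predicate [linear], and directional derivatives along them *)

Section LinearMaps.
Context {R : realType}.
Implicit Types V W Z : normedModType R.

Lemma linear_map0 V W (L : V -> W) : linear L -> L 0 = 0.
Proof.
by move=> lL; have := lL (-1) 0 0; rewrite scaler0 addr0 scaleN1r addNr.
Qed.

Lemma linear_mapZ V W (L : V -> W) : linear L ->
  forall a v, L (a *: v) = a *: L v.
Proof.
by move=> lL a v; have := lL a v 0; rewrite !addr0 linear_map0// addr0.
Qed.

Lemma linear_mapD V W (L : V -> W) : linear L ->
  forall u v, L (u + v) = L u + L v.
Proof. by move=> lL u v; have := lL 1 u v; rewrite !scale1r. Qed.

Lemma linear_mapB V W (L : V -> W) : linear L ->
  forall u v, L (u - v) = L u - L v.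
Proof.
by move=> lL u v; have := lL (-1) v u; rewrite !scaleN1r ![- _ + _]addrC.
Qed.

Lemma linear_row_continuous q W (L : 'rV[R]_q -> W) : linear L -> continuous L.
Proof.
move=> lL.
pose lin := GRing.isLinear.Build _ _ _ _ L lL.
pose L' : {linear 'rV[R]_q -> W} := HB.pack L lin.
exact: (linear_rV_continuous (f := L')).
Qed.

Lemma linear_pair_continuous V W Z (L : V * W -> Z) : linear L ->
  continuous (fun v => L (v, 0)) -> continuous (fun w => L (0, w)) ->
  continuous L.
Proof.
move=> lL c1 c2.
have -> : L = (fun z => L (z.1, 0) + L (0, z.2)).
  apply/funext => -[v w] /=; rewrite -(linear_mapD lL); congr L.
  by congr pair; rewrite /= ?addr0 ?add0r.
move=> z; apply: cvgD.
  by apply: (@continuous_comp _ _ _ fst (fun v => L (v, 0)));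
    [exact: cvg_fst|exact: c1].
by apply: (@continuous_comp _ _ _ snd (fun w => L (0, w)));
  [exact: cvg_snd|exact: c2].
Qed.

Lemma differentiable_linear_map V W (L : V -> W) x : linear L -> continuous L ->
  differentiable L x.
Proof.
move=> lL.
pose lin := GRing.isLinear.Build _ _ _ _ L lL.
pose L' : {linear V -> W} := HB.pack L lin.
exact: (@linear_differentiable _ _ _ L').
Qed.

(** For small nonzero [t] the difference quotient is constantly [c]. This computes every derivative
    of a function that is affine along the direction considered. *)
Lemma derive_near_line V W (f : V -> W) x v c :
  (\forall t \near (0 : R), f (t *: v + x) = f x + t *: c) ->
  'D_v f x = c.
Proof.
move=> fc; apply: lim_near_cst => //.
have fc' : \forall t \near 0^', f (t *: v + x) = f x + t *: c.
  exact: nbhs_dnbhs.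
near=> t; have t0 : t != 0 by near: t; exact: nbhs_dnbhs_neq.
rewrite /= (_ : f (t *: v + x) = f x + t *: c); last by near: t.
by rewrite addrC addKr scalerA mulVf// scale1r.
Unshelve. all: by end_near. Qed.

Lemma derive_linear_map V W (L : V -> W) x v : linear L -> 'D_v L x = L v.
Proof.
move=> lL; apply: derive_near_line; near=> t.
by rewrite (linear_mapD lL) (linear_mapZ lL) addrC.
Unshelve. all: by end_near. Qed.

(** The two difference quotients are the same function of [t]. *)
Lemma derive_comp_affine V W Z (f : W -> Z) (L : V -> W) c x v : linear L ->
  'D_v (fun z => f (L z + c)) x = 'D_(L v) f (L x + c).
Proof.
move=> lL.
have E : (fun t : R => t^-1 *:
      (((fun z => f (L z + c)) \o shift x) (t *: v) - f (L x + c))) =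
    (fun t : R => t^-1 *: ((f \o shift (L x + c)) (t *: L v) - f (L x + c))).
  by apply/funext => t /=; rewrite (linear_mapD lL) (linear_mapZ lL) addrA.
by rewrite /derive E.
Qed.

Lemma derive_comp_linear V W Z (f : W -> Z) (L : V -> W) x v : linear L ->
  'D_v (fun z => f (L z)) x = 'D_(L v) f (L x).
Proof.
move=> lL; have := derive_comp_affine f 0 x v lL; rewrite addr0 => <-.
by congr (derive _ _ _); apply/funext => z; rewrite addr0.
Qed.

Lemma derive_slice V V' W Z (f : V' * W -> Z) (L : V -> V') (w : W) x v :
  linear L -> 'D_v (fun z => f (L z, w)) x = 'D_(L v, 0) f (L x, w).
Proof.
move=> lL.
have lL' : linear (fun z => (L z, 0 : W)).
  by move=> c u u'; congr pair; rewrite /= ?lL// scaler0 addr0.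
have shift0 u : (L u, 0) + (0, w) = (L u, w).
  by congr pair; rewrite /= ?addr0 ?add0r.
rewrite -[in RHS](shift0 x) -(derive_comp_affine f (0, w) x v lL').
by congr (derive _ _ _); apply/funext => z; rewrite shift0.
Qed.

Lemma differentiable_slice V V' W Z (f : V' * W -> Z) (L : V -> V') (w : W) x :
  linear L -> continuous L -> differentiable f (L x, w) ->
  differentiable (fun z => f (L z, w)) x.
Proof.
move=> lL cL df.
apply: (@differentiable_comp _ _ _ _ (fun z => (L z, w)) f) => //.
apply: differentiable_pair; first exact: differentiable_linear_map.
exact: differentiable_cst.
Qed.

Lemma derive_linear_comp V W Z (f : V -> W) (L : W -> Z) x v :
  linear L -> continuous L -> differentiable f x ->
  'D_v (fun z => L (f z)) x = L ('D_v f x).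
Proof.
move=> lL cL df; have dL := differentiable_linear_map (f x) lL cL.
rewrite deriveE; last exact: differentiable_comp.
rewrite (diff_comp df dL) /= -deriveE// derive_linear_map//.
by rewrite -deriveE.
Qed.

End LinearMaps.

(** * Closure properties of continuously differentiable maps *)

Section C1.
Context {R : realType}.
Implicit Types V W Z : normedModType R.

Lemma C1_linear V W (A : set V) (L : V -> W) : linear L -> continuous L ->
  C1_on A L.
Proof.
move=> lL cL x _; split; first exact: differentiable_linear_map.
move=> v; have -> : (fun z => 'D_v L z) = cst (L v).
  by apply/funext => z; exact: derive_linear_map.
exact: cst_continuous.
Qed.

Lemma C1_comp_linear V W Z (A : set W) (f : W -> Z) (L : V -> W) :
  linear L -> continuous L -> C1_on A f ->
  C1_on (L @^-1` A) (fun z => f (L z)).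
Proof.
move=> lL cL f1 x Ax; have [df Df] := f1 _ Ax; split.
  by apply: differentiable_comp => //; exact: differentiable_linear_map.
move=> v; have -> : (fun z => 'D_v (fun z => f (L z)) z) =
    (fun z => 'D_(L v) f (L z)).
  by apply/funext => z; exact: derive_comp_linear.
exact: (@continuous_comp _ _ _ L (fun z => 'D_(L v) f z) x (cL x) (Df (L v))).
Qed.

(** The formula for the derivative of the composite is known on [A]; openness makes it valid near
    each point of [A], as continuity of the derivative there requires. *)
Lemma C1_linear_comp V W Z (A : set V) (f : V -> W) (L : W -> Z) : open A ->
  linear L -> continuous L -> C1_on A f -> C1_on A (fun z => L (f z)).
Proof.
move=> oA lL cL f1 x Ax; have [df Df] := f1 _ Ax; split.
  apply: (@differentiable_comp _ _ _ _ f L) => //.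
  exact: differentiable_linear_map.
move=> v; have E : \forall z \near x,
    L ('D_v f z) = 'D_v (fun z => L (f z)) z.
  have := open_nbhs_nbhs (conj oA Ax); apply: filterS => z Az.
  by have [dfz _] := f1 _ Az; rewrite (derive_linear_comp v lL cL dfz).
have c := @continuous_comp _ _ _ (fun z => 'D_v f z) L x (Df v) (cL _).
have h := near_eq_cvg E.
rewrite /prop_for /continuous_at /= -(nbhs_singleton E).
exact: (cvg_trans (h (nbhs_filter x)) c).
Qed.

Lemma C1_add V W (f g : V -> W) :
  C1_on setT f -> C1_on setT g -> C1_on setT (fun z => f z + g z).
Proof.
move=> f1 g1 x _; have [df Df] := f1 x I; have [dg Dg] := g1 x I.
split; first exact: (@differentiableD _ _ _ f g).
move=> v; have -> : (fun z => 'D_v (fun z => f z + g z) z) =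
    (fun z => 'D_v f z + 'D_v g z).
  apply/funext => z; have [dfz _] := f1 z I; have [dgz _] := g1 z I.
  by rewrite (@deriveD _ _ _ f g) //; exact: diff_derivable.
exact: continuousD (Df v) (Dg v).
Qed.

Lemma C1_mul V (f g : V -> R) :
  C1_on setT f -> C1_on setT g -> C1_on setT (fun z => f z * g z).
Proof.
move=> f1 g1 x _; have [df Df] := f1 x I; have [dg Dg] := g1 x I.
split; first exact: (@differentiableM _ _ f g).
move=> v; have -> : (fun z => 'D_v (fun z => f z * g z) z) =
    (fun z => f z * 'D_v g z + g z * 'D_v f z).
  apply/funext => z; have [dfz _] := f1 z I; have [dgz _] := g1 z I.
  by rewrite (@deriveM _ _ f g) //; exact: diff_derivable.
apply: continuousD; apply: continuousM => //; exact: differentiable_continuous.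
Qed.

Lemma C1_sum V W (I : Type) (s : seq I) (f : I -> V -> W) :
  (forall i, C1_on setT (f i)) -> C1_on setT (fun z => \sum_(i <- s) f i z).
Proof.
move=> f1; elim: s => [|i s IHs].
  have -> : (fun z => \sum_(i <- [::]) f i z) = (fun=> 0).
    by apply/funext => z; rewrite big_nil.
  apply: C1_linear; last exact: cst_continuous.
  by move=> a u v; rewrite scaler0 addr0.
have -> : (fun z => \sum_(j <- i :: s) f j z) =
    (fun z => f i z + \sum_(j <- s) f j z).
  by apply/funext => z; rewrite big_cons.
exact: C1_add.
Qed.

Lemma C1_rV V q (f : V -> 'rV[R]_q) :
  (forall j, C1_on setT (fun z => f z 0 j)) -> C1_on setT f.
Proof.
move=> f1.
have -> : f =
    (fun z => \sum_(j <- index_enum 'I_q) (f z 0 j : R) *: delta_mx 0 j).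
  by apply/funext => z; rewrite -row_sum_delta.
apply: C1_sum => j.
apply: (@C1_linear_comp _ _ _ _ (fun z => f z 0 j)
  (fun a : R => a *: delta_mx 0 j)).
- exact: openT.
- by move=> a u v; rewrite scalerDl scalerA.
- exact: scalel_continuous.
- exact: f1.
Qed.

Lemma C1_mxrow V N (q : 'I_N -> nat) (f : forall k, V -> 'rV[R]_(q k)) :
  (forall k (j : 'I_(q k)), C1_on setT (fun z => f k z 0 j)) ->
  C1_on setT (fun z => \mxrow_k f k z).
Proof.
move=> f1; apply: C1_rV => j.
have -> : (fun z => (\mxrow_k f k z) 0 j) =
    (fun z => f (tagnat.sig1 j) z 0 (tagnat.sig2 j)).
  by apply/funext => z; rewrite mxE.
exact: f1.
Qed.

Lemma C1_row_mx V q r (f : V -> 'rV[R]_q) (g : V -> 'rV[R]_r) :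
  C1_on setT f -> C1_on setT g -> C1_on setT (fun z => row_mx (f z) (g z)).
Proof.
move=> f1 g1.
have -> : (fun z => row_mx (f z) (g z)) =
    (fun z => row_mx (f z) 0 + row_mx 0 (g z)).
  by apply/funext => z; rewrite add_row_mx addr0 add0r.
apply: C1_add.
  have lL : linear (fun u : 'rV[R]_q => row_mx u 0 : 'rV[R]_(q + r)).
    by move=> a u v; rewrite scale_row_mx add_row_mx scaler0 addr0.
  exact: (C1_linear_comp openT lL (linear_row_continuous lL) f1).
have lL : linear (fun u : 'rV[R]_r => row_mx 0 u : 'rV[R]_(q + r)).
  by move=> a u v; rewrite scale_row_mx add_row_mx scaler0 addr0.
exact: (C1_linear_comp openT lL (linear_row_continuous lL) g1).
Qed.

End C1.

(** * Linear independence, orthogonal complements and block vectors *)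

Section LinearAlgebra.
Context {R : realType}.

(** Translates freeness of a sequence, whose coefficients are indexed by positions, into
    coefficients indexed by the constraints themselves. *)
Lemma free_enumP (I : finType) (V : vectType R) (A : {set I}) (f : I -> V) :
  free [seq f i | i <- enum A] <->
  (forall c : I -> R, \sum_(i in A) c i *: f i = 0 ->
     forall i, i \in A -> c i = 0).
Proof.
pose X := [tuple of map f (enum_tuple A)].
have XE (j : 'I_#|A|) : X`_j = f (enum_val j).
  by rewrite /= (nth_map (enum_val j)) -?cardE// -enum_val_nth.
have sumE (c : I -> R) : \sum_(i in A) c i *: f i =
    \sum_(j < #|A|) c (enum_val j) *: X`_j.
  by rewrite big_enum_val; apply: eq_bigr => j _; rewrite XE.
split=> [/(@freeP _ _ _ X) fX c c0 i iA|H].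
  rewrite sumE in c0.
  have := fX (fun j => c (enum_val j)) c0 (enum_rank_in iA i).
  by rewrite enum_rankK_in.
apply/(@freeP _ _ _ X) => k k0 j.
(* Outside [A] the rank takes a default value, which the sum over [A] never sees. *)
pose c i := k (enum_rank_in (enum_valP j) i).
have := H c _ (enum_val j) (enum_valP j); rewrite /c enum_valK_in; apply.
by rewrite sumE -[RHS]k0; apply: eq_bigr => j' _; rewrite /c enum_valK_in.
Qed.

(** Let [G] have rows [f i] for [i] in [A] and 0 elsewhere. The columns of its cokernel matrix are
    orthogonal to all these [f i], hence to [z], and being killed by the cokernel means lying in the
    row space of [G]. *)
Lemma orthogonal_compl_span m q (A : {set 'I_m}) (f : 'I_m -> 'rV[R]_q) z :
  orthogonal_compl [set y | forall i, i \in A -> dotr (f i) y = 0] z ->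
  exists c : 'I_m -> R, z = \sum_(i in A) c i *: f i.
Proof.
move=> zA; pose G : 'M[R]_(m, q) := \matrix_i (if i \in A then f i else 0).
have /submxP[D zE] : (z <= G)%MS.
  rewrite submxE; apply/eqP/rowP => j; rewrite [RHS]mxE.
  have -> : (z *m cokermx G) 0 j = dotr z (col j (cokermx G))^T.
    by rewrite mxE; apply: eq_bigr => i _; rewrite !mxE.
  apply: zA => i iA.
  have /matrixP/(_ i j) := mulmx_coker G; rewrite [RHS]mxE mxE => <-.
  by apply: eq_bigr => a _; rewrite !mxE iA.
exists (fun i => D 0 i); rewrite zE mulmx_sum_row [RHS]big_mkcond.
by apply: eq_bigr => i _; rewrite rowK; case: ifP => // _; rewrite scaler0.
Qed.

Lemma dotr_mxrow N (q : 'I_N -> nat) (x y : 'rV[R]_(\sum_i q i)) :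
  dotr x y = \sum_k dotr (submxrow x k) (submxrow y k).
Proof.
rewrite /dotr sig_big_dep /= (reindex _ (onW_bij _ (@tagnat.rank_bij _ q))) /=.
by apply: eq_big => // -[k j] _ /=; rewrite !mxE.
Qed.

Lemma exists_block N (q : 'I_N -> nat) k (v : 'rV[R]_(q k)) :
  exists2 x : 'rV[R]_(\sum_i q i), submxrow x k = v &
    forall k', k' != k -> submxrow x k' = 0.
Proof.
(* The type of block [k'] depends on [k'], so [v] is transported along the proof of [k' = k]. *)
exists (\mxrow_k' (if k' =P k is ReflectT e
    then castmx (erefl, congr1 q (esym e)) v else 0)).
  by rewrite mxrowK; case: eqP => // e; rewrite (eq_axiomK e) castmx_id.
by move=> k' ; rewrite mxrowK; case: eqP.
Qed.

Lemma dotr0 q (z : 'rV[R]_q) : dotr z 0 = 0.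
Proof. by apply: big1 => i _; rewrite mxE mulr0. Qed.

End LinearAlgebra.

(** * The square KKT system, its smoothness and its derivative *)

Section KKTSystem.
Context {R : realType} {N : nat} (P : nep R N).

Local Notation nx := (\sum_i nvar P i)%N.
Local Notation nl := (\sum_i ncon P i)%N.
Local Notation nw := (\sum_i npar P i)%N.
Local Notation space := 'rV[R]_(nx + nl + nw).
Local Notation parameters := ('rV[R]_nl * 'rV[R]_nx * 'rV[R]_nw)%type.

Definition xpart (z : space) : 'rV[R]_nx := lsubmx (lsubmx z).
Definition lpart (z : space) : 'rV[R]_nl := rsubmx (lsubmx z).
Definition wpart (z : space) : 'rV[R]_nw := rsubmx z.
Definition pack (x : 'rV[R]_nx) (l : 'rV[R]_nl) (w : 'rV[R]_nw) : space :=
  row_mx (row_mx x l) w.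

Lemma xpart_pack x l w : xpart (pack x l w) = x.
Proof. by rewrite /xpart /pack !row_mxKl. Qed.
Lemma lpart_pack x l w : lpart (pack x l w) = l.
Proof. by rewrite /lpart /pack row_mxKl row_mxKr. Qed.
Lemma wpart_pack x l w : wpart (pack x l w) = w.
Proof. by rewrite /wpart /pack row_mxKr. Qed.
Lemma pack_parts z : pack (xpart z) (lpart z) (wpart z) = z.
Proof. by rewrite /pack /xpart /lpart /wpart !hsubmxK. Qed.

Lemma linear_xpart : linear xpart.
Proof. by move=> a u v; rewrite /xpart !linearP. Qed.
Lemma linear_lpart : linear lpart.
Proof. by move=> a u v; rewrite /lpart !linearP. Qed.
Lemma linear_wpart : linear wpart.
Proof. by move=> a u v; rewrite /wpart linearP. Qed.

Lemma submxrowE M (q : 'I_M -> nat) (x : 'rV[R]_(\sum_i q i)) k j :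
  submxrow x k 0 j = x 0 (tagnat.Rank k j).
Proof. by rewrite mxE. Qed.

Lemma linear_submxrow M (q : 'I_M -> nat) k :
  linear (fun x : 'rV[R]_(\sum_i q i) => submxrow x k).
Proof. by move=> a u v; apply/rowP => j; rewrite !mxE. Qed.

Definition joint_point k (z : space) :=
  (xpart z, submxrow (wpart z) k).
Definition own_point k (z : space) :=
  (submxrow (xpart z) k, submxrow (wpart z) k).

Lemma linear_joint_point k : linear (joint_point k).
Proof.
move=> a u v; congr pair; first exact: linear_xpart.
by rewrite linear_wpart linear_submxrow.
Qed.

Lemma linear_own_point k : linear (own_point k).
Proof.
move=> a u v.
by congr pair; rewrite ?linear_xpart ?linear_wpart linear_submxrow.
Qed.

Lemma grad_constrE k (i : 'I_(ncon P k)) xk w a :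
  grad_constr i xk w 0 a = 'D_(delta_mx 0 a, 0) (constr P k i) (xk, w).
Proof.
rewrite mxE /partial.
have lid : linear (@id 'rV[R]_(nvar P k)) by [].
exact: (derive_slice (constr P k i) w xk (delta_mx 0 a) lid).
Qed.

Lemma constr_differentiable k (i : 'I_(ncon P k)) z :
  differentiable (constr P k i) z.
Proof. by have [/(_ z I)[]] := constr_C2 i. Qed.

Lemma cost_differentiable k z : differentiable (cost P k) z.
Proof. by have [/(_ z I)[]] := cost_C2 P k. Qed.

Lemma submxrow_delta M (q : 'I_M -> nat) k (a : 'I_(q k)) :
  submxrow (delta_mx 0 (tagnat.Rank k a) : 'rV[R]_(\sum_i q i)) k =
  delta_mx 0 a.
Proof.
apply/rowP => j; rewrite !mxE !eqxx/=; congr (_%:R); congr nat_of_bool.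
by rewrite -val_eqE tagnat.eq_Rank eqxx.
Qed.

(** Expresses the gradient through derivatives of the data in fixed directions of the joint space of
    strategies and parameters; these are [C1] because the data are [C2]. *)
Lemma grad_lagrangianE k (x : 'rV[R]_nx) lam w (a : 'I_(nvar P k)) :
  grad_lagrangian x lam w 0 a =
    'D_(delta_mx 0 (tagnat.Rank k a), 0) (cost P k) (x, w) +
    \sum_(i < ncon P k) lam 0 i * grad_constr i (submxrow x k) w 0 a.
Proof.
rewrite mxE /partial; set e := delta_mx 0 _.
have lid : linear (@id 'rV[R]_nx) by [].
have cid := linear_row_continuous lid.
have lk := linear_submxrow (q := nvar P) k.
have ck := linear_row_continuous lk.
pose f z := cost P k (z, w).
pose g i (z : 'rV[R]_nx) := constr P k i (submxrow z k, w).
have df : differentiable f x.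
  exact: differentiable_slice lid cid (cost_differentiable _).
have dg i : differentiable (g i) x.
  exact: differentiable_slice lk ck (constr_differentiable i _).
have -> : (fun z => lagrangian z lam w) =
    f + \sum_(i < ncon P k) (lam 0 i *: g i).
  by apply/funext => z; rewrite /lagrangian fctE fct_sumE.
rewrite deriveD; first last.
- by apply: derivable_sum => i; apply: derivableZ; exact: diff_derivable.
- exact: diff_derivable.
rewrite derive_sum; last by move=> i; apply: derivableZ; exact: diff_derivable.
congr (_ + _).
  exact: (derive_slice (cost P k) w x e lid).
apply: eq_bigr => i _; rewrite deriveZ; last exact: diff_derivable.
congr (_ *: _); rewrite grad_constrE -submxrow_delta.
exact: (derive_slice (constr P k i) w x e lk).
Qed.

(** Carrying [w] along as an unknown with an identity component keeps the map square and lets the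
    inverse function theorem serve as an implicit one. *)
Definition kkt_map (J : forall k, {set 'I_(ncon P k)}) (z : space) : space :=
  pack
    (\mxrow_k grad_lagrangian (k := k) (xpart z) (submxrow (lpart z) k)
       (submxrow (wpart z) k))
    (\mxrow_k \row_i (if i \in J k then constr P k i (own_point k z)
                      else submxrow (lpart z) k 0 i))
    (wpart z).

Lemma C1_coord q j (A : set 'rV[R]_q) : C1_on A (fun z : 'rV[R]_q => z 0 j).
Proof.
have lL : linear (fun z : 'rV[R]_q => z 0 j : R^o).
  by move=> a u v; rewrite !mxE.
exact: (C1_linear lL (linear_row_continuous lL)).
Qed.

Lemma C1_lpart k (i : 'I_(ncon P k)) :
  C1_on setT (fun z => submxrow (lpart z) k 0 i).
Proof.
have -> : (fun z => submxrow (lpart z) k 0 i) =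
    (fun z => lpart z 0 (tagnat.Rank k i)).
  by apply/funext => z; rewrite submxrowE.
have lL := linear_lpart; have cL := linear_row_continuous lL.
exact: (C1_comp_linear lL cL (C1_coord (tagnat.Rank k i) (A := setT))).
Qed.

Lemma C1_constr k (i : 'I_(ncon P k)) :
  C1_on setT (fun z => constr P k i (own_point k z)).
Proof.
have lL := linear_own_point k; have cL := linear_row_continuous lL.
exact: (C1_comp_linear lL cL (constr_C2 i).1).
Qed.

Lemma C1_grad_lagrangian k (a : 'I_(nvar P k)) :
  C1_on setT (fun z => grad_lagrangian (k := k) (xpart z) (submxrow (lpart z) k)
                (submxrow (wpart z) k) 0 a).
Proof.
have -> : (fun z => grad_lagrangian (k := k) (xpart z) (submxrow (lpart z) k)
                (submxrow (wpart z) k) 0 a) =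
  (fun z => 'D_(delta_mx 0 (tagnat.Rank k a), 0) (cost P k) (joint_point k z) +
    \sum_(i <- index_enum 'I_(ncon P k)) submxrow (lpart z) k 0 i *
       'D_(delta_mx 0 a, 0) (constr P k i) (own_point k z)).
  apply/funext => z; rewrite grad_lagrangianE; congr (_ + _).
  by apply: eq_bigr => i _; rewrite grad_constrE.
apply: C1_add.
  have lL := linear_joint_point k; have cL := linear_row_continuous lL.
  exact: (C1_comp_linear lL cL ((cost_C2 P k).2 _)).
apply: C1_sum => i; apply: C1_mul; first exact: C1_lpart.
have lL := linear_own_point k; have cL := linear_row_continuous lL.
exact: (C1_comp_linear lL cL ((constr_C2 i).2 _)).
Qed.

Lemma C1_kkt_map J : C1_on setT (kkt_map J).
Proof.
apply: C1_row_mx; first apply: C1_row_mx.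
- by apply: C1_mxrow => k a; exact: C1_grad_lagrangian.
- apply: C1_mxrow => k i.
  have [iJ|iJ] := boolP (i \in J k).
    have -> : (fun z => (\row_i (if i \in J k then constr P k i (own_point k z)
        else submxrow (lpart z) k 0 i)) 0 i) =
        (fun z => constr P k i (own_point k z)).
      by apply/funext => z; rewrite mxE iJ.
    exact: C1_constr.
  have -> : (fun z => (\row_i (if i \in J k then constr P k i (own_point k z)
        else submxrow (lpart z) k 0 i)) 0 i) =
        (fun z => submxrow (lpart z) k 0 i).
    by apply/funext => z; rewrite mxE (negbTE iJ).
  exact: C1_lpart.
- exact: C1_linear linear_wpart (linear_row_continuous linear_wpart).
Qed.

Lemma derive_rV_coord (V : normedModType R) q (f : V -> 'rV[R]_q) z h j :
  differentiable f z -> ('D_h f z) 0 j = 'D_h (fun z => f z 0 j) z.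
Proof. by move=> df; rewrite derive_mx ?mxE//; exact: diff_derivable. Qed.

Lemma kkt_map_differentiable J z : differentiable (kkt_map J) z.
Proof. by have [] := C1_kkt_map J (x := z) I. Qed.

Lemma derive_kkt_map_part q J z h (L : space -> 'rV[R]_q) j : linear L ->
  (L ('D_h (kkt_map J) z)) 0 j = 'D_h (fun z => L (kkt_map J z) 0 j) z.
Proof.
move=> lL; have cL := linear_row_continuous lL.
have dk := kkt_map_differentiable J z.
rewrite -(derive_linear_comp h lL cL dk) derive_rV_coord//.
apply: (@differentiable_comp _ _ _ _ (kkt_map J) L) => //.
exact: differentiable_linear_map.
Qed.

Lemma derive_kkt_map_w J z h : wpart ('D_h (kkt_map J) z) = wpart h.
Proof.
have lW := linear_wpart; have cW := linear_row_continuous lW.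
rewrite -(derive_linear_comp h lW cW (kkt_map_differentiable J z)).
have -> : (fun z => wpart (kkt_map J z)) = wpart.
  by apply/funext => z'; rewrite wpart_pack.
exact: derive_linear_map.
Qed.

Lemma derive_kkt_map_l J z h k i :
  submxrow (lpart ('D_h (kkt_map J) z)) k 0 i =
  if i \in J k then 'D_h (fun z => constr P k i (own_point k z)) z
  else submxrow (lpart h) k 0 i.
Proof.
rewrite submxrowE (derive_kkt_map_part J z h _ linear_lpart).
have -> : (fun z => lpart (kkt_map J z) 0 (tagnat.Rank k i)) =
    (fun z => if i \in J k then constr P k i (own_point k z)
              else submxrow (lpart z) k 0 i).
  by apply/funext => z'; rewrite lpart_pack -submxrowE mxrowK mxE.
case: ifP => // _.
have lL : linear (fun z => submxrow (lpart z) k 0 i : R^o).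
  by move=> a u v; rewrite linear_lpart linear_submxrow !mxE.
exact: derive_linear_map.
Qed.

Lemma derive_kkt_map_x J z h k a :
  submxrow (xpart ('D_h (kkt_map J) z)) k 0 a =
  'D_h (fun z => grad_lagrangian (k := k) (xpart z) (submxrow (lpart z) k)
                (submxrow (wpart z) k) 0 a) z.
Proof.
rewrite submxrowE (derive_kkt_map_part J z h _ linear_xpart).
congr (derive _ _ _); apply/funext => z'.
by rewrite xpart_pack -submxrowE mxrowK.
Qed.

Definition gradient_coord k (a : 'I_(nvar P k)) (z : space) : R :=
  grad_lagrangian (k := k) (xpart z) (submxrow (lpart z) k)
    (submxrow (wpart z) k) 0 a.

Lemma gradient_coord_differentiable k (a : 'I_(nvar P k)) z :
  differentiable (gradient_coord a) z.
Proof. by have [] := C1_grad_lagrangian a (x := z) I. Qed.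

Lemma packD x l w x' l' w' :
  pack x l w + pack x' l' w' = pack (x + x') (l + l') (w + w').
Proof. by rewrite /pack !add_row_mx. Qed.

Lemma packZ c x l w : c *: pack x l w = pack (c *: x) (c *: l) (c *: w).
Proof. by rewrite /pack !scale_row_mx. Qed.

Lemma linear_pack0 : linear (fun x : 'rV[R]_nx => pack x 0 0).
Proof. by move=> c u v; rewrite packZ packD !scaler0 !addr0. Qed.

(** Both sides are linear in [y], and for a basis vector the right side is a second partial
    derivative of the Lagrangian, that is, an entry of the block matrix. *)
Lemma hess_block_row p x l (y : 'rV[R]_nx) k (a : 'I_(nvar P k)) :
  submxrow (hess_block p x l *m y^T)^T k 0 a =
  'D_(pack y 0 0) (gradient_coord a) (pack x l p.2).
Proof.
have dG := gradient_coord_differentiable a (pack x l p.2).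
rewrite submxrowE mxE mxE deriveE//.
pose D v := 'd (gradient_coord a) (pack x l p.2) v.
have lD : linear D by move=> c u v; rewrite /D linearP.
have -> : pack y 0 0 = \sum_(j < nx) (y 0 j : R) *: pack (delta_mx 0 j) 0 0.
  rewrite {1}(row_sum_delta y); apply: (big_ind2 (fun u v => pack u 0 0 = v)).
  - by rewrite /pack !row_mx0.
  - by move=> u1 v1 u2 v2 <- <-; rewrite packD !addr0.
  - by move=> j _; rewrite packZ !scaler0.
rewrite linear_sum; apply: eq_bigr => j _.
rewrite linearZ/= -deriveE// [y^T _ _]mxE mulrC.
congr (_ * _).
(* The joint index [j] is split into a player and one of that player's coordinates. *)
have -> : hess_block p x l (tagnat.Rank k a) j =
    hess_lagrangian (k := k) (tagnat.sig1 j) x (submxrow l k) (par_w p k) a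
      (tagnat.sig2 j).
  rewrite -{1}(tagnat.sig2K j).
  have /matrixP/(_ a (tagnat.sig2 j)) := mxblockK
    (fun k i => hess_lagrangian (k := k) i x (submxrow l k) (par_w p k))
    k (tagnat.sig1 j).
  by rewrite mxE => <-.
rewrite mxE /partial tagnat.sig2K.
have E (z : 'rV[R]_nx) : pack z 0 0 + pack 0 l p.2 = pack z l p.2.
  by rewrite packD addr0 !add0r.
have := derive_comp_affine (gradient_coord a) (pack 0 l p.2) x (delta_mx 0 j)
  linear_pack0.
rewrite E => <-; congr (derive _ _ _); apply/funext => z.
by rewrite E /gradient_coord xpart_pack lpart_pack wpart_pack mxE.
Qed.

(** The gradient of the Lagrangian is affine in the multiplier. *)
Lemma derive_gradient_multiplier x l w (eta : 'rV[R]_nl) k (a : 'I_(nvar P k)) :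
  'D_(pack 0 eta 0) (gradient_coord a) (pack x l w) =
  \sum_(i < ncon P k) submxrow eta k 0 i *
    grad_constr i (submxrow x k) (submxrow w k) 0 a.
Proof.
apply: derive_near_line; near=> t.
rewrite packZ packD /gradient_coord !xpart_pack !lpart_pack !wpart_pack.
rewrite !scaler0 !add0r !grad_lagrangianE -addrA; congr (_ + _).
rewrite scaler_sumr -big_split; apply: eq_bigr => i _ /=.
by rewrite linear_submxrow !mxE mulrDl addrC [t *: _]mulrA.
Unshelve. all: by end_near. Qed.

Lemma derive_gradient_pack p x l (y : 'rV[R]_nx) (eta : 'rV[R]_nl) k
    (a : 'I_(nvar P k)) :
  'D_(pack y eta 0) (gradient_coord a) (pack x l p.2) =
  submxrow (hess_block p x l *m y^T)^T k 0 a +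
  \sum_(i < ncon P k) submxrow eta k 0 i *
    grad_constr i (submxrow x k) (par_w p k) 0 a.
Proof.
rewrite hess_block_row -(derive_gradient_multiplier x l).
have dG := gradient_coord_differentiable a (pack x l p.2).
by rewrite !deriveE// -linearD packD !addr0 add0r.
Qed.

Lemma derive_constr_pack x l w (y : 'rV[R]_nx) (eta : 'rV[R]_nl) k
    (i : 'I_(ncon P k)) :
  'D_(pack y eta 0) (fun z => constr P k i (own_point k z)) (pack x l w) =
  dotr (grad_constr i (submxrow x k) (submxrow w k)) (submxrow y k).
Proof.
rewrite (derive_comp_linear (constr P k i) _ _ (linear_own_point k)).
rewrite /own_point !xpart_pack !wpart_pack.
set v := submxrow y k.
have w0 : submxrow (0 : 'rV[R]_nw) k = 0 by apply/rowP => j; rewrite !mxE.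
rewrite w0.
have dc := constr_differentiable i (submxrow x k, submxrow w k).
have -> : (v, 0) = \sum_(j < nvar P k) (v 0 j : R) *:
    (delta_mx 0 j : 'rV[R]_(nvar P k), 0 : 'rV[R]_(npar P k)).
  rewrite {1}(row_sum_delta v).
  apply: (big_ind2 (fun (u : 'rV[R]_(nvar P k)) v =>
    (u, 0 : 'rV[R]_(npar P k)) = v)) => //.
  - by move=> u1 v1 u2 v2 <- <-; congr pair; rewrite /= addr0.
  - by move=> j _; congr pair; rewrite /= scaler0.
rewrite deriveE// linear_sum; apply: eq_bigr => j _.
by rewrite linearZ/= -deriveE// grad_constrE mulrC.
Qed.

(** Describes the kernel of the derivative as the solution set of the linearized KKT system:
    stationarity, tangency to the constraints in [J], and vanishing multiplier variations outside
    [J]. *)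
Lemma derive_kkt_map_eq0 J p x l y eta w :
  'D_(pack y eta w) (kkt_map J) (pack x l p.2) = 0 <->
  [/\ w = 0,
      forall k, submxrow (hess_block p x l *m y^T)^T k + \sum_(i < ncon P k)
        submxrow eta k 0 i *: grad_constr i (submxrow x k) (par_w p k) = 0,
      forall k i, i \in J k ->
        dotr (grad_constr i (submxrow x k) (par_w p k)) (submxrow y k) = 0 &
      forall k i, i \notin J k -> submxrow eta k 0 i = 0].
Proof.
have gradE k a : (submxrow (hess_block p x l *m y^T)^T k + \sum_(i < ncon P k)
     submxrow eta k 0 i *: grad_constr i (submxrow x k) (par_w p k)) 0 a =
    'D_(pack y eta 0) (gradient_coord a) (pack x l p.2).
  rewrite derive_gradient_pack mxE summxE; congr (_ + _).
  by apply: eq_bigr => i _; rewrite mxE.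
split=> [D0|[-> Hg Hc Hm]].
  have w0 : w = 0.
    have := derive_kkt_map_w J (pack x l p.2) (pack y eta w).
    by rewrite D0 wpart_pack => <-; rewrite (linear_map0 linear_wpart).
  move: D0; rewrite w0 => D0; split => //.
  - move=> k; apply/rowP => a; rewrite gradE.
    have := derive_kkt_map_x J (pack x l p.2) (pack y eta 0) a.
    rewrite D0 (linear_map0 linear_xpart) => <-.
    by rewrite !mxE.
  - move=> k i iJ.
    have := derive_kkt_map_l J (pack x l p.2) (pack y eta 0) i.
    rewrite iJ D0 (linear_map0 linear_lpart) derive_constr_pack => <-.
    by rewrite !mxE.
  - move=> k i iJ.
    have := derive_kkt_map_l J (pack x l p.2) (pack y eta 0) i.
    rewrite (negbTE iJ) D0 (linear_map0 linear_lpart) lpart_pack => <-.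
    by rewrite !mxE.
set D := derive _ _ _; rewrite -(pack_parts D).
have -> : wpart D = 0 by rewrite derive_kkt_map_w wpart_pack.
have -> : xpart D = 0.
  apply/mxrowP => k; apply/rowP => a.
  rewrite derive_kkt_map_x -/(gradient_coord a).
  by rewrite -gradE Hg !mxE.
have -> : lpart D = 0.
  apply/mxrowP => k; apply/rowP => i.
  rewrite derive_kkt_map_l derive_constr_pack.
  have -> : submxrow (0 : 'rV[R]_nl) k 0 i = 0 by rewrite !mxE.
  rewrite lpart_pack; case: ifPn => [iJ|iJ]; [exact: Hc|exact: Hm].
by rewrite /pack !row_mx0.
Qed.

End KKTSystem.

(** * Regularity conditions, and the reduction of the KKT conditions to equations *)

Section Regularity.
Context {R : realType} {N : nat} (P : nep R N).

Local Notation nx := (\sum_i nvar P i)%N.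
Local Notation nl := (\sum_i ncon P i)%N.
Local Notation nw := (\sum_i npar P i)%N.
Local Notation space := 'rV[R]_(nx + nl + nw).
Local Notation parameters := ('rV[R]_nl * 'rV[R]_nx * 'rV[R]_nw)%type.

(** LICQ is injectivity tested on pure multiplier directions. For the second-order condition, a
    Hessian image orthogonal to [Mprod] is a combination of active gradients, whose coefficients
    supply the multiplier part of a kernel vector. Conversely, the linearized stationarity equation
    first forces [y = 0] and then, by LICQ, [eta = 0]. *)
Lemma kkt_map_injectiveP p x l :
  (forall k, SCSC (P := P) p x l k) ->
  (forall h, 'D_h (kkt_map (I1 p x l)) (pack x l p.2) = 0 -> h = 0) <->
  (forall k, LICQ (P := P) p x l k) /\
  (forall y, Mprod (P := P) p x l y ->
     orthogonal_compl (Mprod p x l) (hess_block p x l *m y^T)^T -> y = 0).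
Proof.
move=> scsc.
pose g k i := grad_constr (P := P) (k := k) i (submxrow x k) (par_w p k).
have licqP k : LICQ (P := P) p x l k <->
    forall c : 'I_(ncon P k) -> R, \sum_(i in I1 p x l k) c i *: g k i = 0 ->
      forall i, i \in I1 p x l k -> c i = 0.
  by rewrite /LICQ (scsc k) finset.setU0; exact: free_enumP.
have sumI1 (eta : 'rV[R]_nl) k :
    (forall i, i \notin I1 p x l k -> submxrow eta k 0 i = 0) ->
    \sum_(i < ncon P k) submxrow eta k 0 i *: g k i =
    \sum_(i in I1 p x l k) submxrow eta k 0 i *: g k i.
  move=> eta0; rewrite [RHS]big_mkcond; apply: eq_bigr => i _.
  by case: ifPn => // /eta0 ->; rewrite scale0r.
split=> [inj|[licq soc] h].
  split=> [k|y yM yH].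
    apply/licqP => c c0.
    have [eta etak etak'] := @exists_block R N (ncon P) k
      (\row_i if i \in I1 p x l k then c i else 0).
    have etaI k' i : i \notin I1 p x l k' -> submxrow eta k' 0 i = 0.
      have [kk|/etak' ->] := eqVneq k' k; last by rewrite mxE.
      by move: i; rewrite kk etak => i; rewrite mxE => /negbTE ->.
    have h0 : pack 0 eta 0 = 0.
      apply: inj; apply/derive_kkt_map_eq0; split=> // [k'|k' i _].
        rewrite trmx0 mulmx0 trmx0 submxrow0 add0r (sumI1 _ _ (etaI k')).
        have [->|nk] := eqVneq k' k.
          by rewrite -[RHS]c0; apply: eq_bigr => i iI; rewrite etak mxE iI.
        by apply: big1 => i _; rewrite (etak' _ nk) mxE scale0r.
      by rewrite submxrow0 dotr0.
    have eta0 : eta = 0.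
      by rewrite -(lpart_pack 0 eta 0) h0 (linear_map0 (linear_lpart (P := P))).
    by move=> i iI; have /rowP/(_ i) := etak; rewrite eta0 submxrow0 !mxE iI.
  (* Testing orthogonality against vectors of [Mprod] with a single nonzero block separates the
     players. *)
  have ck k : exists c : 'I_(ncon P k) -> R,
      submxrow (hess_block p x l *m y^T)^T k =
      \sum_(i in I1 p x l k) c i *: g k i.
    apply: orthogonal_compl_span => yk ykM.
    have [y' y'k y'k'] := @exists_block R N (nvar P) k yk.
    have y'M : Mprod p x l y'.
      move=> k' i iI; have [kk|/y'k' ->] := eqVneq k' k; last exact: dotr0.
      by move: i iI; rewrite kk y'k => i iI; exact: ykM.
    have := yH _ y'M; rewrite dotr_mxrow (bigD1 k)//= y'k.
    rewrite [X in dotr _ _ + X]big1 ?addr0// => k' kk'.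
    by rewrite y'k'// dotr0.
  pose c k := sval (cid (ck k)); have cE k := svalP (cid (ck k)).
  (* The minus sign makes the multiplier term cancel the Hessian term. *)
  pose eta : 'rV[R]_nl :=
    \mxrow_k \row_i (if i \in I1 p x l k then - c k i else 0).
  have h0 : pack y eta 0 = 0.
    apply: inj; apply/derive_kkt_map_eq0.
    have etaI k i : i \notin I1 p x l k -> submxrow eta k 0 i = 0.
      by rewrite mxrowK mxE => /negbTE ->.
    split => // k.
    rewrite (sumI1 _ _ (etaI k)) (cE k) -big_split/=; apply: big1 => i iI.
    by rewrite mxrowK mxE iI scaleNr subrr.
  by rewrite -(xpart_pack y eta 0) h0 (linear_map0 (linear_xpart (P := P))).
rewrite -(pack_parts h) => /derive_kkt_map_eq0[-> Hg Hc Hm].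
set y := xpart h in Hg Hc *; set eta := lpart h in Hg Hm *.
(* By stationarity each block of the Hessian image is minus a combination of active gradients, so it
   is orthogonal to [Mprod]. *)
have y0 : y = 0.
  apply: soc => [k i iI|y' y'M]; first exact: Hc.
  rewrite dotr_mxrow; apply: big1 => k _.
  have /eqP := Hg k; rewrite addr_eq0 => /eqP ->.
  rewrite (sumI1 _ _ (Hm k)) /dotr.
  under eq_bigr => a _ do rewrite mxE summxE mulNr mulr_suml.
  rewrite sumrN exchange_big/= [X in - X]big1 ?oppr0// => i iI.
  under eq_bigr => a _ do rewrite mxE -mulrA.
  by rewrite -mulr_sumr -/(dotr _ _) (y'M k i iI) mulr0.
have eta0 : eta = 0.
  apply/mxrowP => k; apply/rowP => i; rewrite submxrow0 [RHS]mxE.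
  have [iI|/Hm//] := boolP (i \in I1 p x l k).
  apply: ((licqP k).1 (licq k) (fun i => submxrow eta k 0 i)) iI.
  have := Hg k.
  by rewrite y0 trmx0 mulmx0 trmx0 submxrow0 add0r (sumI1 _ _ (Hm k)).
by rewrite y0 eta0 /pack !row_mx0.
Qed.

(** Right-hand side of the system: a coordinate outside [J] is 0 because it prescribes the value of
    an inactive multiplier. *)
Definition param_map (J : forall k, {set 'I_(ncon P k)}) (p : parameters) :
    space :=
  pack p.1.2
    (\mxrow_k \row_i (if i \in J k then submxrow p.1.1 k 0 i else 0)) p.2.

Lemma linear_param_map J : linear (param_map J).
Proof.
move=> c u v; rewrite /param_map packZ packD; congr pack.
apply/rowP => j; rewrite !mxE; case: ifP => // _.
by rewrite mulr0 addr0.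
Qed.

Lemma param_map_continuous J : continuous (param_map J).
Proof.
have lM := linear_param_map J; apply: linear_pair_continuous => //.
  have l1 : linear (fun v : 'rV[R]_nl * 'rV[R]_nx => param_map J (v, 0)).
    move=> c u v; rewrite -lM; congr param_map; congr pair.
    by rewrite /= scaler0 addr0.
  apply: linear_pair_continuous => //; apply: linear_row_continuous => c u v;
    by rewrite -l1; congr (param_map J (_, _)); congr pair;
      rewrite /= scaler0 addr0.
apply: linear_row_continuous => c u v; rewrite -lM; congr param_map; congr pair.
by rewrite /= scaler0 addr0.
Qed.

(** Strict inequalities, hence open conditions, that decide which factor of each complementarity
    product must vanish. *)
Definition regime (J : forall k, {set 'I_(ncon P k)}) (z : space)
    (p : parameters) :=
  forall k (i : 'I_(ncon P k)), (neqcon P k <= i)%N ->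
    if i \in J k then 0 < submxrow (lpart z) k 0 i
    else constr P k i (own_point k z) < par_u p k 0 i.

(** In the regime, a positive multiplier forces equality in its constraint and a strict constraint
    forces a zero multiplier; conversely, the regime supplies the sign conditions that the equations
    omit. *)
Lemma kkt_mapP (J : forall k, {set 'I_(ncon P k)}) z p :
  (forall k (i : 'I_(ncon P k)), (i < neqcon P k)%N -> i \in J k) ->
  regime J z p ->
  (wpart z = p.2 /\ S_KKT p (xpart z, lpart z)) <-> kkt_map J z = param_map J p.
Proof.
move=> Jeq reg; split=> [[wE kkt]|E].
  rewrite /kkt_map /param_map wE; congr pack; apply/mxrowP => k; rewrite mxrowK.
    by have [vE _ _] := kkt k; rewrite -[RHS]/(par_v p k) vE.
  rewrite mxrowK; apply/rowP => i; rewrite [LHS]mxE [RHS]mxE /own_point wE.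
  have [_ keq kineq] := kkt k; case: ifPn => iJ.
    have [ieq|ineq] := ltnP i (neqcon P k); first exact: keq.
    have [_ _ /eqP] := kineq i ineq; have := reg k i ineq; rewrite iJ => l0.
    by rewrite mulf_eq0 gt_eqF//= subr_eq0 => /eqP.
  have ineq : (neqcon P k <= i)%N by rewrite leqNgt; apply: contra iJ => /Jeq.
  have := reg k i ineq; rewrite (negbTE iJ) /own_point wE => gu.
  have [_ _ /eqP] := kineq i ineq.
  by rewrite mulf_eq0 subr_eq0 (lt_eqF gu) orbF => /eqP.
have wE : wpart z = p.2.
  by have := congr1 (@wpart _ _ P) E; rewrite !wpart_pack.
have xE := congr1 (@xpart _ _ P) E; rewrite !xpart_pack in xE.
have lE := congr1 (@lpart _ _ P) E; rewrite !lpart_pack in lE.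
split=> // k /=.
have gE i : if i \in J k then constr P k i (submxrow (xpart z) k, par_w p k) =
    par_u p k 0 i else submxrow (lpart z) k 0 i = 0.
  have := congr1 (fun l => submxrow l k 0 i) lE.
  rewrite !mxrowK [LHS]mxE [RHS]mxE.
  by rewrite /own_point wE; case: ifP.
split=> [|i ieq|i ineq].
- by rewrite /par_v -xE mxrowK wE.
- by have := gE i; rewrite Jeq.
- have := gE i; have := reg k i ineq; case: ifP => iJ.
    by move=> /ltW l0 ->; rewrite subrr mulr0 lexx.
  by rewrite /own_point wE => gu ->; rewrite mul0r lexx ltW.
Qed.

Lemma I1_eq p x l k (i : 'I_(ncon P k)) :
  (i < neqcon P k)%N -> i \in I1 p x l k.
Proof. by move=> ieq; rewrite inE ieq. Qed.

(** Complementarity makes one of multiplier and slack vanish, and strict complementarity excludes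
    that both do. *)
Lemma base_regime p x l : S_KKT p (x, l) -> (forall k, SCSC (P := P) p x l k) ->
  regime (I1 p x l) (pack x l p.2) p.
Proof.
move=> kkt scsc k i ineq; have [_ _ /(_ i ineq)/= [l0 gu lg0]] := kkt k.
rewrite lpart_pack /own_point xpart_pack wpart_pack.
have /setP/(_ i) := scsc k; rewrite !inE ineq ltnNge ineq/= /slack.
rewrite subr_eq0.
have [->|s0] := eqVneq (submxrow l k 0 i) 0.
  by rewrite ltxx/= => gu'; rewrite lt_neqAle gu' gu.
have -> : 0 < submxrow l k 0 i by rewrite lt_neqAle eq_sym s0.
by move: lg0 => /eqP; rewrite mulf_eq0 (negbTE s0)/= subr_eq0 => ->.
Qed.

(** There are finitely many strict inequalities, each between functions continuous in [(z, p)]. *)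
Lemma regime_near (J : forall k, {set 'I_(ncon P k)}) z p : regime J z p ->
  nbhs (z, p) [set zp | regime J zp.1 zp.2].
Proof.
move=> reg.
pose ok k (i : 'I_(ncon P k)) : set (space * parameters) :=
  [set zp | (neqcon P k <= i)%N ->
    if i \in J k then 0 < submxrow (lpart zp.1) k 0 i
    else constr P k i (own_point k zp.1) < par_u zp.2 k 0 i].
have okn k (i : 'I_(ncon P k)) : nbhs (z, p) (@ok k i).
  have [ineq|ieq] := leqP (neqcon P k) i; last first.
    by apply: (@filterE _ (nbhs (z, p))) => zp; rewrite /ok/= leqNgt ieq.
  have := reg k i ineq; rewrite /ok; case: (i \in J k) => H.
    have cl : {for z, continuous (fun z => submxrow (lpart z) k 0 i)}.
      by have [dl _] := C1_lpart i (x := z) I; exact: differentiable_continuous.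
    have cl' : submxrow (lpart zp.1) k 0 i @[zp --> (z, p)] -->
        submxrow (lpart z) k 0 i.
      by apply: (@continuous_comp _ _ _ fst (fun z => submxrow (lpart z) k 0 i)
        (z, p)); [exact: cvg_fst|exact: cl].
    have := @cvgr_gt _ _ _ (nbhs_filter (z, p)) _ _ cl' _ H.
    by apply: (@filterS _ (nbhs (z, p)) (nbhs_filter _)) => zp lz _.
  have cg : {for z, continuous (fun z => constr P k i (own_point k z))}.
    by have [dl _] := C1_constr i (x := z) I; exact: differentiable_continuous.
  have lu : linear (fun u : 'rV[R]_nl => submxrow u k 0 i : R^o).
    by move=> c u v; rewrite linear_submxrow !mxE.
  have cu := linear_row_continuous lu.
  have cg' : (fun zp : space * parameters => constr P k i (own_point k zp.1)
      - par_u zp.2 k 0 i) zp @[zp --> (z, p)] -->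
      constr P k i (own_point k z) - par_u p k 0 i.
    apply: cvgB.
      by apply: (@continuous_comp _ _ _ fst
        (fun z => constr P k i (own_point k z)) (z, p));
        [exact: cvg_fst|exact: cg].
    apply: (@continuous_comp _ _ _ (fun zp : space * parameters => zp.2.1.1)
      (fun u : 'rV[R]_nl => submxrow u k 0 i) (z, p)); last exact: cu.
    apply: (@continuous_comp _ _ _ (fun zp : space * parameters => zp.2.1)
      fst (z, p)); last exact: cvg_fst.
    apply: (@continuous_comp _ _ _ (fun zp : space * parameters => zp.2)
      fst (z, p)); [exact: cvg_snd|exact: cvg_fst].
  have H0 : constr P k i (own_point k z) - par_u p k 0 i < 0.
    by rewrite subr_lt0.
  have := @cvgr_lt _ _ _ (nbhs_filter (z, p)) _ _ cg' _ H0.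
  apply: (@filterS _ (nbhs (z, p)) (nbhs_filter _)).
  by move=> zp; rewrite /= subr_lt0 => gz _.
have okk k : nbhs (z, p) [set zp | forall i, @ok k i zp].
  exact: (@filter_forall _ _ (@ok k) _ (nbhs_filter (z, p)) (okn k)).
exact: (@filter_forall _ _ (fun k => [set zp | forall i, @ok k i zp]) _
  (nbhs_filter (z, p)) okk).
Qed.

End Regularity.

(** * From localizations to strict complementarity and injectivity, and back *)

Section Localization.
Context {R : realType} {N : nat} (P : nep R N).

Local Notation nx := (\sum_i nvar P i)%N.
Local Notation nl := (\sum_i ncon P i)%N.
Local Notation nw := (\sum_i npar P i)%N.
Local Notation space := 'rV[R]_(nx + nl + nw).
Local Notation parameters := ('rV[R]_nl * 'rV[R]_nx * 'rV[R]_nw)%type.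

Lemma localizationP p x l (U : set parameters)
    (V : set ('rV[R]_nx * 'rV[R]_nl)) sigma :
  [set z | S_KKT z.1 z.2] `&` (U `*` V) = [set z | U z.1 /\ z.2 = sigma z.1] ->
  S_KKT (P := P) p (x, l) -> U p -> V (x, l) -> (x, l) = sigma p.
Proof.
move=> E kkt pU xV.
have : ([set z | S_KKT (P := P) z.1 z.2] `&` (U `*` V)) (p, (x, l)) by [].
by rewrite E => -[].
Qed.

Lemma near_line (V : normedModType R) (a h : V) (A : set V) : nbhs a A ->
  \forall t \near (0 : R), A (t *: h + a).
Proof.
move=> aA.
have d : differentiable (fun t : R => t *: h + a) (0 : R).
  apply: (@differentiableD _ R^o V (fun t : R => t *: h) (cst a)).
    apply: differentiable_linear_map; last exact: scalel_continuous.
    by move=> c u v; rewrite scalerDl scalerA.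
  exact: differentiable_cst.
have c := @differentiable_continuous _ R^o V 0 (fun t : R => t *: h + a) d.
by apply: c; rewrite /= scale0r add0r.
Qed.

Lemma scsc_of_localization p x l k :
  S_KKT (P := P) p (x, l) ->
  has_C1_localization (@S_KKT R N P) p (x, l) -> SCSC (P := P) p x l k.
Proof.
move=> kkt [_ [U [V [sigma [[oU Up] [oV Vx] sC1 E]]]]].
apply/setP => j; rewrite finset.in_set0; apply/negP.
rewrite inE => /and3P[jineq].
move=> /eqP lj0 sj0.
have sigma_unique q x' l' := @localizationP q x' l' U V sigma E.
have sigma_kkt q : U q -> S_KKT q (sigma q).
  move=> Uq; have : [set z | U z.1 /\ z.2 = sigma z.1] (q, sigma q) by [].
  by rewrite -E => -[].
have sigmap : sigma p = (x, l) by rewrite -(sigma_unique p x l).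
(* Moving along [e] changes only the bound of the degenerate constraint [j] of player [k]. *)
pose e : parameters := (delta_mx 0 (tagnat.Rank k j), 0, 0).
pose theta (q : parameters) :=
  constr P k j (submxrow (sigma q).1 k, par_w p k).
have par_ve t k' : par_v (P := P) (t *: e + p) k' = par_v p k'.
  by rewrite /par_v /= scaler0 add0r.
have par_we t k' : par_w (P := P) (t *: e + p) k' = par_w p k'.
  by rewrite /par_w /= scaler0 add0r.
have par_ue t k' i : par_u (P := P) (t *: e + p) k' 0 i =
    t * (tagnat.Rank k' i == tagnat.Rank k j)%:R + par_u p k' 0 i.
  by rewrite /par_u !submxrowE !mxE eqxx.
have slack0 : constr P k j (submxrow x k, par_w p k) = par_u p k 0 j.
  by apply/eqP; rewrite -subr_eq0.
(* With a relaxed bound [(x, l)] stays a KKT pair, its multiplier at [j] being 0; by uniqueness it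
   is the value of [sigma]. *)
have theta_pos t : 0 <= t -> U (t *: e + p) -> theta (t *: e + p) = theta p.
  move=> t0 Ue; rewrite /theta -(sigma_unique (t *: e + p) x l) ?sigmap//.
  move=> k'; have [vE keq kineq] := kkt k'.
  rewrite /= par_ve par_we; split=> //.
    move=> i ieq; rewrite par_ue; have [ij|_] := eqVneq; last first.
      by rewrite mulr0 add0r; exact: keq.
    have := tagnat.eq_Rank i j; rewrite ij eqxx => /esym/andP[/eqP kk /eqP ijn].
    by exfalso; move: ieq; rewrite ijn kk ltnNge jineq.
  move=> i iineq; have [li0 gu lg0] := kineq i iineq; rewrite par_ue.
  have [ij|_] := eqVneq; last by rewrite mulr0 add0r.
  have -> : submxrow l k' 0 i = 0 by rewrite submxrowE ij -submxrowE.
  rewrite mul0r lexx mulr1; split => //; apply: le_trans gu _.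
  by rewrite lerDr.
(* This is feasibility of [sigma] for constraint [j], which is active at the reference point. *)
have theta_neg t : U (t *: e + p) -> theta (t *: e + p) <= t + theta p.
  move=> Ue; have [_ _ /(_ j jineq)[_ +  _]] := sigma_kkt _ Ue k.
  by rewrite par_ue eqxx mulr1 par_we /theta sigmap slack0.
have ds : differentiable sigma p by have [] := sC1 p Up.
have dtheta : differentiable theta p.
  apply: (@differentiable_comp _ _ _ _
    (fun q => (submxrow (sigma q).1 k, par_w p k)) (constr P k j)).
    apply: differentiable_pair; last exact: differentiable_cst.
    apply: (@differentiable_comp _ _ _ _ sigma
      (fun z : 'rV[R]_nx * 'rV[R]_nl => submxrow z.1 k)) => //.
    apply: differentiable_linear_map.
      by move=> c u v; exact: linear_submxrow.
    have lk := linear_submxrow (q := nvar P) k.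
    move=> z; apply: (@continuous_comp _ _ _ fst
      (fun z : 'rV[R]_nx => submxrow z k)); first exact: cvg_fst.
    exact: linear_row_continuous.
  exact: constr_differentiable.
have := diff_derivable (v := e) dtheta; rewrite /derivable.
(* The quotient is 0 on the right and at least 1 on the left, so no [D] lies within [1/4] of
   both. *)
move=> /cvg_ex[D]/cvgrPdist_lt/(_ (1/4)) H.
have /H{}H : 0 < 1/4 :> R by rewrite divr_gt0.
have HU : \forall t \near (0 : R), U (t *: e + p).
  by apply: near_line; exact: open_nbhs_nbhs.
pose N1 := [set t : R | t != 0 ->
  `|D - t^-1 * (theta (t *: e + p) - theta p)| < 1/4].
have /nbhs_ballP[d /= d0 Hd] : nbhs (0 : R) (N1 `&` [set t | U (t *: e + p)]).
  by apply: filterI; [exact: H|exact: HU].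
have d2 : d / 2 < d by rewrite ltr_pdivrMr// ltr_pMr// ltr1n.
have d20 : 0 < d / 2 by rewrite divr_gt0.
have [|H1 U1] := Hd (d / 2).
  by rewrite -ball_normE /ball_/= sub0r normrN gtr0_norm.
have [|H2 U2] := Hd (- (d / 2)).
  by rewrite -ball_normE /ball_/= sub0r opprK gtr0_norm.
move: H1 H2; rewrite /N1/= oppr_eq0 gt_eqF// => /(_ isT) + /(_ isT).
rewrite theta_pos ?ltW// subrr mulr0 subr0 => H1 H2.
have H3 : 1 <= (- (d / 2))^-1 * (theta (- (d / 2) *: e + p) - theta p).
  by rewrite ler_ndivlMl ?oppr_lt0// mulr1 lerBlDr; exact: theta_neg.
move: H1 H2; rewrite !ltr_norml => /andP[_ H1] /andP[H2 _].
clear -H1 H2 H3; lra.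
Qed.

Definition unpack (z : space) : 'rV[R]_nx * 'rV[R]_nl := (xpart z, lpart z).

Lemma linear_unpack : linear unpack.
Proof. by move=> c u v; rewrite /unpack linear_xpart linear_lpart. Qed.

(* A right inverse of [param_map J] on the vectors whose multiplier
   coordinates outside [J] vanish. *)
Definition to_param (z : space) : parameters := (lpart z, xpart z, wpart z).

Lemma linear_to_param : linear to_param.
Proof.
by move=> c u v; rewrite /to_param linear_xpart linear_lpart linear_wpart.
Qed.

Lemma to_paramK (J : forall k, {set 'I_(ncon P k)}) z :
  (forall k (i : 'I_(ncon P k)), i \notin J k ->
     submxrow (lpart z) k 0 i = 0) ->
  param_map J (to_param z) = z.
Proof.
move=> z0; rewrite -[RHS]pack_parts; congr pack.
apply/mxrowP => k; rewrite mxrowK; apply/rowP => i; rewrite mxE /=.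
by case: ifPn => // /z0.
Qed.

Lemma injective_of_localization p x l :
  S_KKT (P := P) p (x, l) -> (forall k, SCSC (P := P) p x l k) ->
  has_C1_localization (@S_KKT R N P) p (x, l) ->
  forall h, 'D_h (kkt_map (I1 p x l)) (pack x l p.2) = 0 -> h = 0.
Proof.
move=> kkt scsc [_ [U [V [sigma [[oU Up] [oV Vx] sC1 E]]]]] h.
set a := pack x l p.2; set J := I1 p x l; set Phi := kkt_map J => Dh0.
have Jeq : forall k (i : 'I_(ncon P k)), (i < neqcon P k)%N -> i \in J k.
  by move=> k i; exact: I1_eq.
have rega : regime J a p := base_regime kkt scsc.
have Phia : Phi a = param_map J p.
  apply/(kkt_mapP Jeq rega).
  by rewrite /a wpart_pack xpart_pack lpart_pack.
have dPhi z : differentiable Phi z by exact: kkt_map_differentiable.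
have lK := linear_to_param; have cK := linear_row_continuous lK.
(* The parameter follows the variation of [Phi], with a constant chosen so that [Psi a = p]; its
   derivative along [h] vanishes with that of [Phi]. *)
pose Psi z := to_param (Phi z) + (p - to_param (Phi a)).
have Psia : Psi a = p by rewrite /Psi addrC subrK.
have dKPhi z : differentiable (fun z => to_param (Phi z)) z.
  apply: (@differentiable_comp _ _ _ _ Phi to_param) => //.
  exact: differentiable_linear_map.
have dPsi z : differentiable Psi z.
  apply: (@differentiableD _ _ _ (fun z => to_param (Phi z))
    (cst (p - to_param (Phi a)))) => //; exact: differentiable_cst.
have DPsi : 'D_h Psi a = 0.
  rewrite (@deriveD _ _ _ (fun z => to_param (Phi z))
    (cst (p - to_param (Phi a)))); first last.
  - exact: derivable_cst.
  - exact: diff_derivable.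
  rewrite derive_cst addr0 (derive_linear_comp _ lK cK)//.
  by rewrite Dh0 (linear_map0 lK).
have ds : differentiable sigma (Psi a) by rewrite Psia; have [] := sC1 p Up.
have DS : 'D_h (fun z => sigma (Psi z)) a = 0.
  rewrite deriveE; last exact: (@differentiable_comp _ _ _ _ Psi sigma).
  by rewrite (diff_comp (dPsi a) ds) /= -(deriveE h (dPsi a)) DPsi linear0.
have cPsi : {for a, continuous Psi} by exact: differentiable_continuous.
have lU := linear_unpack; have cU := linear_row_continuous lU.
(* This condition and the next two hold near [a], hence on a short piece of the line through [a] in
   direction [h]; there the KKT reduction and the localization both apply. *)
have near1 : nbhs a [set z | regime J z (Psi z)].
  have c : {for a, continuous (fun z => (z, Psi z))}.
    by apply: differentiable_continuous; exact: differentiable_pair.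
  by have := regime_near rega; rewrite -Psia => /c.
have near2 : nbhs a [set z | U (Psi z)].
  by have := open_nbhs_nbhs (conj oU Up); rewrite -Psia => /cPsi.
have near3 : nbhs a [set z | V (unpack z)].
  have := open_nbhs_nbhs (conj oV Vx).
  have -> : (x, l) = unpack a by rewrite /unpack /a xpart_pack lpart_pack.
  by move=> /cU.
have line : \forall t \near (0 : R),
    sigma (Psi (t *: h + a)) = unpack (t *: h + a).
  have near123 := near_line h (filterI near1 (filterI near2 near3)).
  near=> t.
  have : ([set z | regime J z (Psi z)] `&`
      ([set z | U (Psi z)] `&` [set z | V (unpack z)])) (t *: h + a).
    by near: t; exact: near123.
  set z := t *: h + a => -[/= reg [/= Uz Vz]].
  apply/esym; apply: (localizationP E) => //.
  suff : wpart z = (Psi z).2 /\ S_KKT (Psi z) (xpart z, lpart z) by case.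
  apply/(kkt_mapP Jeq reg).
  have lM := linear_param_map J.
  rewrite /Psi (linear_mapD lM) (linear_mapB lM) -Phia addrCA -(linear_mapB lM).
  rewrite -(linear_mapB lK) to_paramK; first by rewrite addrC subrK.
  move=> k i iJ.
  (* [Phi] preserves the multiplier coordinates outside [J], so those of [h] vanish with the
     derivative and stay constant along the line; this is what [to_paramK] demands. *)
  pose c y := submxrow (lpart y) k 0 i.
  have lc : linear (c : space -> R^o).
    by move=> b u v; rewrite /c linear_lpart linear_submxrow !mxE.
  have cPhi y : c (Phi y) = c y.
    by rewrite /c lpart_pack mxrowK mxE (negbTE iJ).
  have ch : c h = 0.
    have := derive_kkt_map_l J a h i; rewrite (negbTE iJ) Dh0 => h0.
    by rewrite /c -h0; exact: (linear_map0 lc).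
  rewrite -/(c _) (linear_mapB lc) !cPhi -(linear_mapB lc) /z addrK.
  by rewrite (linear_mapZ lc) ch scaler0.
(* Along the line [sigma] composed with [Psi] equals the affine map [unpack], so its zero derivative
   is [unpack h]. *)
have unpackh : unpack h = 0.
  rewrite -DS; apply/esym; apply: derive_near_line; near=> t.
  have -> : sigma (Psi (t *: h + a)) = unpack (t *: h + a) by near: t.
  rewrite (linear_mapD lU) (linear_mapZ lU) addrC; congr (_ + _).
  by rewrite Psia -(localizationP E kkt)// /unpack /a xpart_pack lpart_pack.
have wh : wpart h = 0.
  rewrite -(derive_kkt_map_w J a h) Dh0.
  exact: (linear_map0 (linear_wpart (P := P))).
case: unpackh => xh lh.
by rewrite -(pack_parts h) xh lh wh /pack !row_mx0.
Unshelve. all: by end_near. Qed.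

Lemma C1_on_sub (V W : normedModType R) (A B : set V) (f : V -> W) :
  A `<=` B -> C1_on B f -> C1_on A f.
Proof. by move=> AB f1 z /AB; exact: f1. Qed.

Lemma pack_continuous : continuous
  (fun z : 'rV[R]_nx * 'rV[R]_nl * 'rV[R]_nw => pack z.1.1 z.1.2 z.2).
Proof.
pose f (z : 'rV[R]_nx * 'rV[R]_nl * 'rV[R]_nw) : space := pack z.1.1 z.1.2 z.2.
have lf : linear f by move=> c u v; rewrite /f packZ packD.
apply: (linear_pair_continuous lf).
  have l1 : linear (fun v : 'rV[R]_nx * 'rV[R]_nl => f (v, 0)).
    by move=> c u v; rewrite /f packZ packD /= scaler0 addr0.
  apply: (linear_pair_continuous l1); apply: linear_row_continuous => c u v;
    by rewrite /f packZ packD /= !scaler0 !addr0.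
apply: linear_row_continuous => c u v.
by rewrite /f packZ packD /= !scaler0 !addr0.
Qed.

(** The localization is the local inverse of [kkt_map] composed with the linear map [param_map].
    What remains is to shrink the neighbourhoods so that the KKT conditions and the equations agree
    on them. *)
Lemma localization_of_injective p x l :
  S_KKT (P := P) p (x, l) -> (forall k, SCSC (P := P) p x l k) ->
  (forall h, 'D_h (kkt_map (I1 p x l)) (pack x l p.2) = 0 -> h = 0) ->
  has_C1_localization (@S_KKT R N P) p (x, l).
Proof.
move=> kkt scsc; set a := pack x l p.2; set J := I1 p x l.
set Phi := kkt_map J => inj.
have Jeq : forall k (i : 'I_(ncon P k)), (i < neqcon P k)%N -> i \in J k.
  by move=> k i; exact: I1_eq.
have rega : regime J a p := base_regime kkt scsc.
pose M := param_map J.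
have Phia : Phi a = M p.
  apply/(kkt_mapP Jeq rega).
  by rewrite /a wpart_pack xpart_pack lpart_pack.
have lM : linear M := linear_param_map J.
have cM : continuous M := @param_map_continuous R N P J.
have [A [W [G [[oA Aa] [oW Wa] G1 GW GF]]]] :=
  inverse_function_theorem (C1_kkt_map J) inj.
rewrite -/Phi in Wa GW GF.
have GMp : G (M p) = a by rewrite -Phia; exact: GF.
have lU := linear_unpack; have cU := linear_row_continuous lU.
pose sigma q := unpack (G (M q)).
have oMW : open (M @^-1` W) by apply: open_comp => // z _; exact: cM.
have MWp : (M @^-1` W) p by rewrite /= -Phia.
have sC1 : C1_on (M @^-1` W) sigma.
  exact: (C1_linear_comp oMW lU cU (C1_comp_linear lM cM G1)).
have sigmap : sigma p = (x, l).
  by rewrite /sigma GMp /unpack /a xpart_pack lpart_pack.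
have [[A' Q] /= [nA' nQ] regAQ] := regime_near rega.
(* [A] gives uniqueness of the solution of the system and [A'] gives the regime; both must be
   expressed through [(x, l)] and [w] separately. *)
have : nbhs ((x, l), p.2) [set z | (A `&` A') (pack z.1.1 z.1.2 z.2)].
  apply: (@pack_continuous ((x, l), p.2)); apply: filterI => //.
  exact: open_nbhs_nbhs.
move=> [[V0 W0] /= [nV0 nW0] packAA'].
pose V := V0°.
have oV : open_nbhs (x, l) V by split; [exact: open_interior|exact: nV0].
have c2 : {for p, continuous (fun q : parameters => q.2)} by exact: cvg_snd.
have cs : {for p, continuous sigma}.
  by have [ds _] := sC1 p MWp; exact: differentiable_continuous.
(* The four conditions ensure, in order, the regime on the parameter side, control of [w],
   membership in the domain of [G], and that [sigma] takes values in [V]. *)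
pose U0 := Q `&` ((fun q => q.2) @^-1` W0) `&` (M @^-1` W) `&` (sigma @^-1` V).
have nU0 : nbhs p U0.
  apply: filterI; last by apply: cs; rewrite sigmap; exact: open_nbhs_nbhs.
  apply: filterI; last exact: open_nbhs_nbhs.
  by apply: filterI => //; exact: c2.
split => //; exists U0°, V, sigma; split => //.
- by split; [exact: open_interior|exact: nU0].
- by apply: C1_on_sub sC1 => q /interior_subset[[_ ?] _].
apply/seteqP; split=> [[q [x' l']] [/= kq [Uq Vz]]|[q z] [/= Uq ->]].
  split=> //=; have [[[Qq W0q] Wq] _] := interior_subset Uq.
  have [Az A'z] := packAA' ((x', l'), q.2) (conj (interior_subset Vz) W0q).
  rewrite /= in Az A'z; set zz := pack x' l' q.2 in Az A'z.
  have reg : regime J zz q by exact: (regAQ (zz, q)).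
  have Phiz : Phi zz = M q.
    apply/(kkt_mapP Jeq reg).
    by rewrite /zz wpart_pack xpart_pack lpart_pack.
  by rewrite /sigma -Phiz GF ?Phiz// /unpack /zz xpart_pack lpart_pack.
have [[[Qq W0q] Wq] Vq] := interior_subset Uq.
split=> //=; set zz := G (M q).
have [_ Phiz] := GW _ Wq; rewrite -/zz in Phiz.
(* This identifies [zz] with the packing of [sigma q] and [q.2], the point to which the
   neighbourhood [A'] applies. *)
have wz : wpart zz = q.2.
  by have := congr1 (@wpart _ _ P) Phiz; rewrite !wpart_pack.
have [_ A'z] := packAA' (sigma q, q.2) (conj (interior_subset Vq) W0q).
rewrite /sigma -/zz -wz /unpack /= pack_parts in A'z.
have reg : regime J zz q by exact: (regAQ (zz, q)).
by have [] := (kkt_mapP Jeq reg).2 Phiz.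
Qed.

End Localization.

Theorem theorem4p1 (R : realType) (N : nat) (P : nep R N)
    (pbar : 'rV[R]_(\sum_i ncon P i) * 'rV[R]_(\sum_i nvar P i)
            * 'rV[R]_(\sum_i npar P i))
    (xbar : 'rV[R]_(\sum_i nvar P i)) (lbar : 'rV[R]_(\sum_i ncon P i))
    (hKKT : S_KKT pbar (xbar, lbar)) :
  has_C1_localization (@S_KKT R N P) pbar (xbar, lbar)
  <->
  [/\ forall k : 'I_N, SCSC pbar xbar lbar k,
      forall k : 'I_N, LICQ pbar xbar lbar k &
      forall y : 'rV[R]_(\sum_i nvar P i),
        Mprod pbar xbar lbar y ->
        orthogonal_compl (Mprod pbar xbar lbar)
          (hess_block pbar xbar lbar *m y^T)^T ->
        y = 0].
Proof.
split=> [loc|[scsc licq soc]].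
  have scsc k := scsc_of_localization k hKKT loc.
  have inj := injective_of_localization hKKT scsc loc.
  by have [licq soc] := (kkt_map_injectiveP scsc).1 inj.
apply: localization_of_injective => //.
by apply/(kkt_map_injectiveP scsc).
Qed.
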